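(* For each standard $d\ge 2$, $\mathsf{RCA}_0^{\ast}$ proves: for all $c,m\in\mathbb{N}$, $$wr^d_c(m)\le T_{d-2}\bigl(m^{kc}\bigr),\qquad\text{where }k=(d+1)!.$$
   Context: $\mathsf{RCA}_0^{\ast}$ is the subsystem of second order arithmetic, in the usual language augmented by a binary function symbol $\exp$ (written $m^n$), whose axioms are: the basic axioms of second order arithmetic (the usual quantifier-free axioms for $0,1,+,\cdot,<$); the exponentiation axioms $m^0=1$, $m^{n+1}=m\cdot m^n$; the induction scheme for all $\Sigma^0_0$ formulas (possibly containing $\exp$); and the comprehension scheme for all $\Delta^0_1$ formulas (possibly containing $\exp$). $\mathbb{N}$ is the set of nonnegative integers, and $c\in\mathbb{N}$ is identified with $\{0,\dots,c-1\}$. $[0,R]=\{n\in\mathbb{N}:n\le R\}$ and $[0,R]^d=\{(x_0,\dots,x_{d-1})\in\mathbb{N}^d:0\le x_0<\cdots<x_{d-1}\le R\}$. For a coloring $C\colon[0,R]^d\to c$, a set $H=\{h_0<h_1<\cdots\}\subseteq[0,R]$ is $C$-weakly homogeneous if $C(h_i,\dots,h_{i+d-1})=C(h_{i+1},\dots,h_{i+d})$ for all $h_i,h_{i+1},\dots,h_{i+d}$ in $H$. $wr^d_c(m)$ is the smallest $R$ such that for every coloring $C\colon[0,R]^d\to c$ there exists a $C$-weakly homogeneous set of size $m+1$. $T_n$ is the exponential tower with $n$ twos: $T_0(x)=x$ and $T_{n+1}(x)=2^{T_n(x)}$. Standard $d$ means an actual natural number of the metatheory. *)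

(* Defs.v *)
From Stdlib Require Import List Arith.
Import ListNotations.

(** * Second order arithmetic with exponentiation

    Both sorts use de Bruijn indices, in two independent index spaces: one for
    number variables (bound by [AllNum], [ExNum]) and one for set variables (bound
    by [AllSet], [ExSet]). *)

Inductive term : Type :=
| Var (x : nat)
| Zero
| One
| Plus (s t : term)
| Mult (s t : term)
| Exp (s t : term).

(** The only set terms are variables, and equality is between numbers only. *)
Inductive form : Type :=
| Eq (s t : term)
| Lt (s t : term)
| Mem (t : term) (X : nat)
| Bot
| Imp (A B : form)
| And (A B : form)
| Or (A B : form)
| AllNum (A : form)
| ExNum (A : form)
| AllSet (A : form)
| ExSet (A : form).

Definition Not (A : form) : form := Imp A Bot.
Definition Iff (A B : form) : form := And (Imp A B) (Imp B A).
Definition Top : form := Not Bot.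
Definition Le (s t : term) : form := Or (Lt s t) (Eq s t).
Definition Conj (l : list form) : form := fold_right And Top l.

Declare Scope fml_scope.
Delimit Scope fml_scope with fml.
Bind Scope fml_scope with form.
Notation "s ≐ t" := (Eq s t) (at level 70) : fml_scope.
Notation "s ≺ t" := (Lt s t) (at level 70) : fml_scope.
Notation "s ≼ t" := (Le s t) (at level 70) : fml_scope.
Notation "t ∈ X" := (Mem t X) (at level 70) : fml_scope.
Notation "A ⩑ B" := (And A B) (at level 80, right associativity) : fml_scope.
Notation "A ⩒ B" := (Or A B) (at level 85, right associativity) : fml_scope.
Notation "A ⟶ B" := (Imp A B) (at level 90, right associativity) : fml_scope.
Notation "A ⟷ B" := (Iff A B) (at level 95) : fml_scope.
Open Scope fml_scope.

(** ** Substitution *)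

Definition scons {X : Type} (x : X) (f : nat -> X) (n : nat) : X :=
  match n with 0 => x | S n => f n end.

Fixpoint subst_term (s : nat -> term) (t : term) : term :=
  match t with
  | Var x => s x
  | Zero => Zero
  | One => One
  | Plus a b => Plus (subst_term s a) (subst_term s b)
  | Mult a b => Mult (subst_term s a) (subst_term s b)
  | Exp a b => Exp (subst_term s a) (subst_term s b)
  end.

Definition shift (k : nat) (t : term) : term :=
  subst_term (fun n => Var (k + n)) t.

Definition up_num (s : nat -> term) : nat -> term :=
  scons (Var 0) (fun n => shift 1 (s n)).
Definition up_set (r : nat -> nat) : nat -> nat :=
  scons 0 (fun X => S (r X)).

(** Simultaneous substitution of terms for number variables ([s]) and renaming
    of set variables ([r]). *)
Fixpoint subst (s : nat -> term) (r : nat -> nat) (A : form) : form :=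
  match A with
  | Eq t u => Eq (subst_term s t) (subst_term s u)
  | Lt t u => Lt (subst_term s t) (subst_term s u)
  | Mem t X => Mem (subst_term s t) (r X)
  | Bot => Bot
  | Imp A B => Imp (subst s r A) (subst s r B)
  | And A B => And (subst s r A) (subst s r B)
  | Or A B => Or (subst s r A) (subst s r B)
  | AllNum A => AllNum (subst (up_num s) r A)
  | ExNum A => ExNum (subst (up_num s) r A)
  | AllSet A => AllSet (subst s (up_set r) A)
  | ExSet A => ExSet (subst s (up_set r) A)
  end.

Definition shiftN (A : form) : form := subst (fun n => Var (S n)) (fun X => X) A.
Definition shiftS (A : form) : form := subst Var S A.
Definition instN (t : term) (A : form) : form := subst (scons t Var) (fun X => X) A.
Definition instS (Y : nat) (A : form) : form := subst Var (scons Y (fun X => X)) A.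

(** ** Provability: classical two-sorted natural deduction with equality

    [proves T G A]: [A] is derivable from the axioms [T] and the open
    hypotheses [G].  Axioms may have free variables and stand for their
    universal closures; this is why the introduction and elimination rules for
    quantifiers shift [G] but leave [T] alone. *)
Inductive proves (T : form -> Prop) : list form -> form -> Prop :=
| pr_ax G A : T A -> proves T G A
| pr_hyp G A : In A G -> proves T G A
| pr_impI G A B : proves T (A :: G) B -> proves T G (A ⟶ B)
| pr_impE G A B : proves T G (A ⟶ B) -> proves T G A -> proves T G B
| pr_andI G A B : proves T G A -> proves T G B -> proves T G (A ⩑ B)
| pr_andE1 G A B : proves T G (A ⩑ B) -> proves T G A
| pr_andE2 G A B : proves T G (A ⩑ B) -> proves T G B
| pr_orI1 G A B : proves T G A -> proves T G (A ⩒ B)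
| pr_orI2 G A B : proves T G B -> proves T G (A ⩒ B)
| pr_orE G A B C :
    proves T G (A ⩒ B) -> proves T (A :: G) C -> proves T (B :: G) C ->
    proves T G C
| pr_raa G A : proves T (Not A :: G) Bot -> proves T G A
| pr_allNI G A : proves T (map shiftN G) A -> proves T G (AllNum A)
| pr_allNE G A t : proves T G (AllNum A) -> proves T G (instN t A)
| pr_exNI G A t : proves T G (instN t A) -> proves T G (ExNum A)
| pr_exNE G A B :
    proves T G (ExNum A) -> proves T (A :: map shiftN G) (shiftN B) ->
    proves T G B
| pr_allSI G A : proves T (map shiftS G) A -> proves T G (AllSet A)
| pr_allSE G A Y : proves T G (AllSet A) -> proves T G (instS Y A)
| pr_exSI G A Y : proves T G (instS Y A) -> proves T G (ExSet A)
| pr_exSE G A B :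
    proves T G (ExSet A) -> proves T (A :: map shiftS G) (shiftS B) ->
    proves T G B
| pr_eq_refl G t : proves T G (t ≐ t)
| pr_eq_subst G A s t :
    proves T G (s ≐ t) -> proves T G (instN s A) -> proves T G (instN t A).

(** * The theory RCA_0^* *)

(** Set variables may occur freely, set quantifiers may not.  The bound of a
    bounded quantifier is shifted so that it cannot contain the variable being
    quantified. *)
Inductive sigma00 : form -> Prop :=
| s00_eq s t : sigma00 (s ≐ t)
| s00_lt s t : sigma00 (s ≺ t)
| s00_mem t X : sigma00 (t ∈ X)
| s00_bot : sigma00 Bot
| s00_imp A B : sigma00 A -> sigma00 B -> sigma00 (A ⟶ B)
| s00_and A B : sigma00 A -> sigma00 B -> sigma00 (A ⩑ B)
| s00_or A B : sigma00 A -> sigma00 B -> sigma00 (A ⩒ B)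
| s00_all t A : sigma00 A -> sigma00 (AllNum (Var 0 ≺ shift 1 t ⟶ A))
| s00_ex t A : sigma00 A -> sigma00 (ExNum (Var 0 ≺ shift 1 t ⩑ A)).

Inductive sigma01 : form -> Prop :=
| s01 A : sigma00 A -> sigma01 (ExNum A).

Inductive pi01 : form -> Prop :=
| p01 A : sigma00 A -> pi01 (AllNum A).

(** The schemes allow number and set parameters.  In [ax_ind], [Var 0] is the
    induction variable of [A]. In [ax_comp], [Var 0] is the element variable of
    [A] and [B]; [shiftS] keeps the new set from occurring in [A]. *)
Inductive RCA0star : form -> Prop :=
| ax_succ_nonzero : RCA0star (Not (Plus (Var 0) One ≐ Zero))
| ax_succ_inj :
    RCA0star (Plus (Var 0) One ≐ Plus (Var 1) One ⟶ Var 0 ≐ Var 1)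
| ax_plus_zero : RCA0star (Plus (Var 0) Zero ≐ Var 0)
| ax_plus_succ :
    RCA0star (Plus (Var 0) (Plus (Var 1) One) ≐ Plus (Plus (Var 0) (Var 1)) One)
| ax_mult_zero : RCA0star (Mult (Var 0) Zero ≐ Zero)
| ax_mult_succ :
    RCA0star (Mult (Var 0) (Plus (Var 1) One)
                ≐ Plus (Mult (Var 0) (Var 1)) (Var 0))
| ax_lt_zero : RCA0star (Not (Var 0 ≺ Zero))
| ax_lt_succ :
    RCA0star (Var 0 ≺ Plus (Var 1) One ⟷ (Var 0 ≺ Var 1 ⩒ Var 0 ≐ Var 1))
| ax_exp_zero : RCA0star (Exp (Var 0) Zero ≐ One)
| ax_exp_succ :
    RCA0star (Exp (Var 0) (Plus (Var 1) One)
                ≐ Mult (Var 0) (Exp (Var 0) (Var 1)))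
| ax_ind A :
    sigma00 A ->
    RCA0star (instN Zero A
                ⩑ AllNum (A ⟶ subst (scons (Plus (Var 0) One) (fun n => Var (S n)))
                              (fun X => X) A)
              ⟶ AllNum A)
| ax_comp A B :
    sigma01 A -> pi01 B ->
    RCA0star (AllNum (A ⟷ B) ⟶ ExSet (AllNum (Var 0 ∈ 0 ⟷ shiftS A))).

(** * Functions and finite tuples inside second order arithmetic *)

(** The usual pairing (i,j) = (i+j)^2 + i of second order arithmetic. *)
Definition opair (s t : term) : term := Plus (Mult (Plus s t) (Plus s t)) s.

(** (x_0,...,x_n) = ((x_0,...,x_{n-1}),x_n).  The empty tuple is never used. *)
Definition tuple (l : list term) : term :=
  match l with [] => Zero | x :: l => fold_left opair l x end.

Definition vars (start len : nat) : list term := map Var (seq start len).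

Fixpoint alls (n : nat) (A : form) : form :=
  match n with 0 => A | S n => AllNum (alls n A) end.
Fixpoint exs (n : nat) (A : form) : form :=
  match n with 0 => A | S n => ExNum (exs n A) end.

(** [A] defines a class of numbers, [Var 0] being the element.  [elem_at k t A]
    says, under [k] further number quantifiers, that [t] is in that class. *)
Definition elem_at (k : nat) (t : term) (A : form) : form :=
  subst (scons t (fun n => Var (k + n))) (fun X => X) A.

(** The set [f] is (the graph of) a function from the class [A] to the class
    [B], both classes having their element as [Var 0]. *)
Definition is_function (f : nat) (A B : form) : form :=
  AllNum (Var 0 ∈ f ⟶
        ExNum (ExNum (Var 2 ≐ opair (Var 1) (Var 0)
                  ⩑ elem_at 3 (Var 1) A ⩑ elem_at 3 (Var 0) B)))
  ⩑ AllNum (AllNum (AllNum (opair (Var 2) (Var 1) ∈ f ⩑ opair (Var 2) (Var 0) ∈ f ⟶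
                      Var 1 ≐ Var 0)))
  ⩑ AllNum (A ⟶ ExNum (opair (Var 1) (Var 0) ∈ f)).

Definition below (t : term) : form := Var 0 ≺ shift 1 t.
Definition upto (t : term) : form := Var 0 ≼ shift 1 t.
Definition elements (H : nat) : form := Var 0 ∈ H.

(** x < y_1 < ... < y_n <= R for [l] = y_1,...,y_n *)
Fixpoint chain (x : term) (l : list term) (R : term) : form :=
  match l with
  | [] => x ≼ R
  | y :: l => x ≺ y ⩑ chain y l R
  end.
Definition increasing (l : list term) (R : term) : form :=
  match l with [] => Top | x :: l => chain x l R end.

(** * Weak homogeneity *)

(** The class [0,R]^d of (codes of) increasing [d]-tuples from [0,R]; the
    element [Var 0] of the class becomes [Var d] under the [d] quantifiers. *)
Definition tuples (d : nat) (R : term) : form :=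
  exs d (Var d ≐ tuple (vars 0 d) ⩑ increasing (vars 0 d) (shift (S d) R)).

Definition coloring (d : nat) (C : nat) (R c : term) : form :=
  is_function C (tuples d R) (below c).

(** [h] is the increasing enumeration h_0 < ... < h_{n-1} of the set [H]. *)
Definition enumerates (h H : nat) (n : term) : form :=
  is_function h (below n) (elements H)
  ⩑ AllNum (AllNum (AllNum (AllNum
      (opair (Var 3) (Var 1) ∈ h ⩑ opair (Var 2) (Var 0) ∈ h ⩑ Var 3 ≺ Var 2 ⟶
       Var 1 ≺ Var 0))))
  ⩑ AllNum (Var 0 ∈ H ⟶ ExNum (opair (Var 0) (Var 1) ∈ h)).

Fixpoint numeral (n : nat) : term :=
  match n with 0 => Zero | S n => Plus (numeral n) One end.

(** C(h_i,...,h_{i+d-1}) = C(h_{i+1},...,h_{i+d}) whenever h_i,...,h_{i+d}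
    exist.  Under the quantifiers, i is [Var (S d)] and h_{i+j} is [Var j]. *)
Definition consecutive_equal (d : nat) (C h : nat) : form :=
  AllNum (alls (S d)
    (Conj (map (fun j => opair (Plus (Var (S d)) (numeral j)) (Var j) ∈ h)
               (seq 0 (S d)))
     ⟶ ExNum (opair (tuple (vars 1 d)) (Var 0) ∈ C
            ⩑ opair (tuple (vars 2 d)) (Var 0) ∈ C))).

(** [H] is a [C]-weakly homogeneous set of size [n]. *)
Definition weakly_homogeneous (d : nat) (C H : nat) (n : term) : form :=
  ExSet (enumerates 0 (S H) n ⩑ consecutive_equal d (S C) 0).

(** Every coloring C : [0,R]^d -> c has a C-weakly homogeneous set H, contained
    in [0,R], of size m+1. *)
Definition weak_ramsey (d : nat) (c m R : term) : form :=
  AllSet (coloring d 0 R c ⟶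
        ExSet (AllNum (Var 0 ∈ 0 ⟶ Var 0 ≼ shift 1 R)
             ⩑ weakly_homogeneous d 1 0 (Plus m One))).

(** wr^d_c(m) = R *)
Definition is_wr (d : nat) (c m R : term) : form :=
  weak_ramsey d c m R
  ⩑ AllNum (Var 0 ≺ shift 1 R ⟶
          Not (weak_ramsey d (shift 1 c) (shift 1 m) (Var 0))).

Fixpoint tower (n : nat) (t : term) : term :=
  match n with
  | 0 => t
  | S n => Exp (Plus One One) (tower n t)
  end.

(** For all c and m, wr^d_c(m) exists and is at most T_{d-2}(m^{kc}) with
    k = (d+1)!; here c is [Var 2], m is [Var 1] and wr^d_c(m) is [Var 0]. *)
Definition wr_bound (d : nat) : form :=
  AllNum (AllNum (ExNum
    (is_wr d (Var 2) (Var 1) (Var 0)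
     ⩑ Var 0 ≼ tower (d - 2)
                 (Exp (Var 1) (Mult (numeral (fact (d + 1))) (Var 2)))))).

(* Main.v *)
(** By a completeness theorem for [proves] (Henkin's construction), it suffices to
    prove the statement in an arbitrary model of RCA_0^*.  There, numbers code
    finite sequences by their digits, and Sigma^0_0 induction gives codes for all
    bounded Sigma^0_0-definable sequences.

    Suppose a coloring of [[0,R]^d] has no weakly homogeneous set of size [m+1].
    Label a [(d-1)]-tuple by the vector giving, for each color [j], the length of
    the longest path of [j]-colored consecutive [d]-tuples ending in it.  There
    are at most [m^c] labels, and [(x_0,...,x_{d-2})], [(x_1,...,x_{d-1})]
    always get different ones.  From such a labelling of [(e+1)]-tuples with [L]
    labels one gets one of [e]-tuples with [2^L] labels: label [x] by the set of
    all labels of extensions [(x,z)].  After [d-2] steps [[0,R]] is mapped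
    injectively into [T_{d-2}(m^c)], so [R < T_{d-2}(m^c)] by the pigeonhole
    principle.  The least [R] exists because, below a fixed bound, the Ramsey
    statement is equivalent to a Sigma^0_0 formula about codes. *)

From Stdlib Require Import List Arith Lia Classical ClassicalEpsilon Ring.
From Stdlib Require Import FunctionalExtensionality PropExtensionality Cantor.
Require Import Defs.
Import ListNotations.

(** The theory lacks $\Sigma^0_1$ induction, so every induction, maximum or counting argument must
    run on a formula whose quantifiers are bounded in advance. Exponentiation supplies the bounds: a
    sequence of length [n] with entries below [b] is a number below [b ^ n]. This is why colorings
    and homogeneous sets are traded for numbers before any combinatorics starts.

    Standardness of $d$ decides where objects live. The size $m+1$ and the number $c$ of colors may
    be nonstandard, so homogeneous sequences and label vectors are digit codes inside the model. A
    $d$-tuple is a list of the metatheory, a quantifier over tuples is a fixed number of bounded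
    quantifiers, and the descent from $(d-1)$-tuples to single points is an induction outside the
    model.

    The labellings are proper colorings of shift graphs, and the power set step is the classical
    passage from $L$ colors to $2^L$ colors when the tuples become shorter by one. The argument
    yields the exponent $c$, which the factor $(d+1)!$ enlarges. Path labels need $m>0$ and tuples
    that fit into $m+1$ places, so $c=0$ and $m<d$ are treated apart. *)

(** * The calculus of substitutions *)

Lemma subst_term_comp s s' t :
  subst_term s (subst_term s' t) = subst_term (fun n => subst_term s (s' n)) t.
Proof. induction t; simpl; congruence. Qed.

Lemma subst_term_id t : subst_term Var t = t.
Proof. induction t; simpl; congruence. Qed.

Lemma subst_term_shift s k t :
  subst_term s (shift k t) = subst_term (fun n => s (k + n)) t.
Proof. unfold shift. now rewrite subst_term_comp. Qed.

Lemma subst_term_scons_shift s u t : subst_term (scons u s) (shift 1 t) = subst_term s t.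
Proof. now rewrite subst_term_shift. Qed.

Lemma up_num_comp s s' :
  (fun n => subst_term (up_num s) (up_num s' n)) = up_num (fun n => subst_term s (s' n)).
Proof.
  extensionality n. destruct n as [|n]; [reflexivity|]. simpl.
  unfold up_num at 1. rewrite subst_term_scons_shift.
  unfold shift. now rewrite subst_term_comp.
Qed.

Lemma up_set_comp r r' : (fun n => up_set r (up_set r' n)) = up_set (fun n => r (r' n)).
Proof. extensionality n. now destruct n. Qed.

Lemma subst_comp s r s' r' A :
  subst s r (subst s' r' A)
  = subst (fun n => subst_term s (s' n)) (fun n => r (r' n)) A.
Proof.
  revert s r s' r'; induction A; intros s0 r s' r'; simpl; rewrite ?subst_term_comp,
    ?IHA1, ?IHA2, ?IHA, ?up_num_comp, ?up_set_comp; reflexivity.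
Qed.

Lemma up_num_Var : up_num Var = Var.
Proof. extensionality n. now destruct n. Qed.

Lemma up_set_id : up_set (fun X => X) = (fun X => X).
Proof. extensionality n. now destruct n. Qed.

Lemma subst_id A : subst Var (fun X => X) A = A.
Proof.
  induction A; simpl; rewrite ?subst_term_id, ?up_num_Var, ?up_set_id; congruence.
Qed.

Lemma scons_eta {X} (f : nat -> X) : scons (f 0) (fun n => f (S n)) = f.
Proof. extensionality n. now destruct n. Qed.

Lemma instN_subst t s r A :
  instN t (subst (up_num s) r A) = subst (scons t s) r A.
Proof.
  unfold instN. rewrite subst_comp. f_equal.
  extensionality n. destruct n as [|n]; [reflexivity|]. simpl.
  now rewrite subst_term_scons_shift, subst_term_id.
Qed.

Lemma instS_subst Y s r A :
  instS Y (subst s (up_set r) A) = subst s (scons Y r) A.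
Proof.
  unfold instS. rewrite subst_comp. f_equal.
  - extensionality n. apply subst_term_id.
  - extensionality n. now destruct n.
Qed.

Lemma subst_instN s r t A :
  subst s r (instN t A) = instN (subst_term s t) (subst (up_num s) r A).
Proof.
  rewrite instN_subst. unfold instN. rewrite subst_comp. f_equal.
  extensionality n. now destruct n.
Qed.

Lemma subst_instS s r Y A :
  subst s r (instS Y A) = instS (r Y) (subst s (up_set r) A).
Proof.
  rewrite instS_subst. unfold instS. rewrite subst_comp. f_equal.
  extensionality n. now destruct n.
Qed.

Lemma subst_shiftN s r A : subst (up_num s) r (shiftN A) = shiftN (subst s r A).
Proof. unfold shiftN. now rewrite !subst_comp. Qed.

Lemma subst_shiftS s r A : subst s (up_set r) (shiftS A) = shiftS (subst s r A).
Proof.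
  unfold shiftS. rewrite !subst_comp. f_equal.
  extensionality n. simpl. now rewrite subst_term_id.
Qed.

(** * Bounds on free variables *)

(** Phrased by the action of substitutions, so that no occurrence relation is needed; one [N] serves
    for both sorts. Freshness of a variable is always used in this form. *)
Definition free_below (N : nat) (A : form) : Prop :=
  forall s s' r r', (forall k, k < N -> s k = s' k) -> (forall k, k < N -> r k = r' k) ->
  subst s r A = subst s' r' A.

Lemma term_free_below t :
  exists N, forall s s', (forall k, k < N -> s k = s' k) -> subst_term s t = subst_term s' t.
Proof.
  induction t as [x| | |a [M HM] b [N HN]|a [M HM] b [N HN]|a [M HM] b [N HN]].
  1: exists (S x); simpl; auto.
  1,2: exists 0; reflexivity.
  all: exists (M + N); intros s s' Hs; simpl; f_equal; [apply HM|apply HN]; intros;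
    apply Hs; lia.
Qed.

Lemma up_num_ext N s s' :
  (forall k, k < N -> s k = s' k) -> forall k, k < N -> up_num s k = up_num s' k.
Proof. intros H [|k] Hk; [reflexivity|]. unfold up_num; simpl. rewrite H; auto; lia. Qed.

Lemma up_set_ext N r r' :
  (forall k, k < N -> r k = r' k) -> forall k, k < N -> up_set r k = up_set r' k.
Proof. intros H [|k] Hk; [reflexivity|]. unfold up_set; simpl. rewrite H; auto; lia. Qed.

Lemma free_below_exists A : exists N, free_below N A.
Proof.
  induction A as [t u|t u|t X| |A [M HM] B [N HN]|A [M HM] B [N HN]|A [M HM] B [N HN]
                 |A [M HM]|A [M HM]|A [M HM]|A [M HM]].
  1,2: destruct (term_free_below t) as [M HM], (term_free_below u) as [N HN];
    exists (M + N); intros s s' r r' Hs Hr; simpl; f_equal; [apply HM|apply HN]; intros;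
    apply Hs; lia.
  - destruct (term_free_below t) as [M HM]. exists (M + S X).
    intros s s' r r' Hs Hr; simpl; f_equal; [apply HM; intros; apply Hs|apply Hr]; lia.
  - exists 0; intros ? ? ? ? _ _; reflexivity.
  - exists (M + N); intros s s' r r' Hs Hr; simpl; f_equal; [apply HM|apply HN]; intros;
      (apply Hs || apply Hr); lia.
  - exists (M + N); intros s s' r r' Hs Hr; simpl; f_equal; [apply HM|apply HN]; intros;
      (apply Hs || apply Hr); lia.
  - exists (M + N); intros s s' r r' Hs Hr; simpl; f_equal; [apply HM|apply HN]; intros;
      (apply Hs || apply Hr); lia.
  - exists M; intros s s' r r' Hs Hr; simpl; f_equal; apply HM; eauto using up_num_ext.
  - exists M; intros s s' r r' Hs Hr; simpl; f_equal; apply HM; eauto using up_num_ext.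
  - exists M; intros s s' r r' Hs Hr; simpl; f_equal; apply HM; eauto using up_set_ext.
  - exists M; intros s s' r r' Hs Hr; simpl; f_equal; apply HM; eauto using up_set_ext.
Qed.

Lemma free_below_list (L : list form) : exists N, forall A, In A L -> free_below N A.
Proof.
  induction L as [|A L [N HN]]; [exists 0; simpl; tauto|].
  destruct (free_below_exists A) as [M HM]. exists (M + N). intros B [<-|HB].
  - intros s s' r r' Hs Hr. apply HM; intros; [apply Hs|apply Hr]; lia.
  - intros s s' r r' Hs Hr. apply (HN B HB); intros; [apply Hs|apply Hr]; lia.
Qed.

(** * Weakening *)

Lemma weakening T G A : proves T G A -> forall G', incl G G' -> proves T G' A.
Proof.
  induction 1; intros G' HG.
  - now apply pr_ax.
  - now apply pr_hyp, HG.
  - apply pr_impI, IHproves, incl_cons; [apply in_eq|now apply incl_tl].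
  - apply pr_impE with A; auto.
  - apply pr_andI; auto.
  - apply pr_andE1 with B; auto.
  - apply pr_andE2 with A; auto.
  - apply pr_orI1; auto.
  - apply pr_orI2; auto.
  - apply pr_orE with A B; [now apply IHproves1|apply IHproves2|apply IHproves3];
      (apply incl_cons; [apply in_eq|now apply incl_tl]).
  - apply pr_raa, IHproves, incl_cons; [apply in_eq|now apply incl_tl].
  - apply pr_allNI, IHproves, incl_map, HG.
  - apply pr_allNE; auto.
  - apply pr_exNI with t; auto.
  - apply pr_exNE with A; [now apply IHproves1|apply IHproves2].
    apply incl_cons; [apply in_eq|apply incl_tl, incl_map, HG].
  - apply pr_allSI, IHproves, incl_map, HG.
  - apply pr_allSE; auto.
  - apply pr_exSI with Y; auto.
  - apply pr_exSE with A; [now apply IHproves1|apply IHproves2].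
    apply incl_cons; [apply in_eq|apply incl_tl, incl_map, HG].
  - apply pr_eq_refl.
  - apply pr_eq_subst with s; auto.
Qed.

(** ** Substitution instances of theorems *)

Definition prepend {X} (l : list X) (s : nat -> X) : nat -> X := fold_right scons s l.

Lemma prepend_map_seq {X} (f s : nat -> X) n k :
  k < n -> prepend (map f (seq 0 n)) s k = f k.
Proof.
  assert (H : forall a k, k < n -> prepend (map f (seq a n)) s k = f (a + k)).
  2: exact (H 0 k).
  clear k. induction n as [|n IH]; intros a [|k] Hk; try lia; simpl.
  - f_equal; lia.
  - rewrite IH by lia. f_equal; lia.
Qed.

Lemma subst_alls s r n A : subst s r (alls n A) = alls n (subst (Nat.iter n up_num s) r A).
Proof.
  revert s; induction n as [|n IH]; intros s; [reflexivity|].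
  change (AllNum (subst (up_num s) r (alls n A))
    = AllNum (alls n (subst (Nat.iter (S n) up_num s) r A))).
  rewrite IH, Nat.iter_succ_r. reflexivity.
Qed.

Lemma prepend_up_num l s :
  (fun k => subst_term (prepend l Var) (Nat.iter (length l) up_num s k)) = prepend l s.
Proof.
  induction l as [|t l IH]; extensionality k; simpl.
  - apply subst_term_id.
  - destruct k as [|k]; [reflexivity|]. unfold up_num at 1.
    cbn [scons]. rewrite subst_term_scons_shift. exact (f_equal (fun f => f k) IH).
Qed.

(** The outermost quantifier binds the highest index, so the list is consumed from its end. *)
Lemma alls_elim T G l A :
  proves T G (alls (length l) A) -> proves T G (subst (prepend l Var) (fun X => X) A).
Proof.
  revert A. induction l as [|t l IH] using rev_ind; intros A H.
  - simpl in *. now rewrite subst_id.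
  - rewrite length_app, Nat.add_comm in H. simpl in H.
    apply pr_allNE with (t := t) in H. unfold instN in H. rewrite subst_alls in H.
    apply IH in H. rewrite subst_comp in H. rewrite prepend_up_num in H.
    unfold prepend in *. now rewrite fold_right_app.
Qed.

Fixpoint allsS (n : nat) (A : form) : form :=
  match n with 0 => A | S n => AllSet (allsS n A) end.

Lemma subst_allsS s r n A : subst s r (allsS n A) = allsS n (subst s (Nat.iter n up_set r) A).
Proof.
  revert r; induction n as [|n IH]; intros r; [reflexivity|].
  change (AllSet (subst s (up_set r) (allsS n A))
    = AllSet (allsS n (subst s (Nat.iter (S n) up_set r) A))).
  rewrite IH, Nat.iter_succ_r. reflexivity.
Qed.

Lemma prepend_up_set l r :
  (fun k => prepend l (fun X => X) (Nat.iter (length l) up_set r k)) = prepend l r.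
Proof.
  induction l as [|t l IH]; extensionality k; simpl; [reflexivity|].
  destruct k as [|k]; [reflexivity|]. unfold up_set at 1.
  exact (f_equal (fun f => f k) IH).
Qed.

Lemma allsS_elim T G l A :
  proves T G (allsS (length l) A) -> proves T G (subst Var (prepend l (fun X => X)) A).
Proof.
  revert A. induction l as [|t l IH] using rev_ind; intros A H.
  - simpl in *. now rewrite subst_id.
  - rewrite length_app, Nat.add_comm in H. simpl in H.
    apply pr_allSE with (Y := t) in H. unfold instS in H. rewrite subst_allsS in H.
    apply IH in H. rewrite subst_comp in H. rewrite prepend_up_set in H.
    unfold prepend in *. rewrite fold_right_app. exact H.
Qed.

(** Induction on the derivation would get stuck at axioms, as [T] need not be closed under
    substitution. Instead, generalize over the finitely many variables that can occur in [A] and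
    instantiate them by the values of [r] and [s]; without hypotheses nothing blocks the
    generalization. *)
Lemma proves_subst_nil T A s r : proves T [] A -> proves T [] (subst s r A).
Proof.
  intros H. destruct (free_below_exists A) as [N HN].
  assert (H1 : proves T [] (subst Var r A)).
  { rewrite (HN Var Var r (prepend (map r (seq 0 N)) (fun X => X)));
      [|auto|intros; now rewrite prepend_map_seq].
    apply allsS_elim. rewrite length_map, length_seq.
    clear HN. induction N as [|N IH]; [exact H|]. apply pr_allSI, IH. }
  destruct (free_below_exists (subst Var r A)) as [M HM].
  replace (subst s r A) with (subst s (fun X => X) (subst Var r A))
    by now rewrite subst_comp.
  rewrite (HM s (prepend (map s (seq 0 M)) Var) (fun X => X) (fun X => X));
    [|intros; now rewrite prepend_map_seq|auto].
  apply alls_elim. rewrite length_map, length_seq.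
  clear HM. induction M as [|M IH]; [exact H1|]. apply pr_allNI, IH.
Qed.

Lemma proves_subst T G A :
  proves T G A -> forall s r, proves T (map (subst s r) G) (subst s r A).
Proof.
  assert (mapN : forall G s r,
    map shiftN (map (subst s r) G) = map (subst (up_num s) r) (map shiftN G)).
  { intros. rewrite !map_map. apply map_ext. intros. now rewrite subst_shiftN. }
  assert (mapS : forall G s r,
    map shiftS (map (subst s r) G) = map (subst s (up_set r)) (map shiftS G)).
  { intros. rewrite !map_map. apply map_ext. intros. now rewrite subst_shiftS. }
  induction 1; intros s0 r; simpl in *.
  - apply weakening with []; [|intros ? []]. apply proves_subst_nil. now apply pr_ax.
  - apply pr_hyp, in_map, H.
  - apply pr_impI, IHproves.
  - eapply pr_impE; eauto.
  - apply pr_andI; auto.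
  - eapply pr_andE1; eauto.
  - eapply pr_andE2; eauto.
  - apply pr_orI1; auto.
  - apply pr_orI2; auto.
  - eapply pr_orE; eauto.
  - apply pr_raa, IHproves.
  - apply pr_allNI. rewrite mapN. apply IHproves.
  - rewrite subst_instN. apply pr_allNE, IHproves.
  - apply pr_exNI with (subst_term s0 t). rewrite <- subst_instN. apply IHproves.
  - apply pr_exNE with (subst (up_num s0) r A); [apply IHproves1|].
    rewrite mapN, <- subst_shiftN. apply IHproves2.
  - apply pr_allSI. rewrite mapS. apply IHproves.
  - rewrite subst_instS. apply pr_allSE, IHproves.
  - apply pr_exSI with (r Y). rewrite <- subst_instS. apply IHproves.
  - apply pr_exSE with (subst s0 (up_set r) A); [apply IHproves1|].
    rewrite mapS, <- subst_shiftS. apply IHproves2.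
  - apply pr_eq_refl.
  - rewrite subst_instN. apply pr_eq_subst with (subst_term s0 s); [apply IHproves1|].
    rewrite <- subst_instN. apply IHproves2.
Qed.

(** ** Structures *)

Record structure := {
  num : Type;
  zero : num;
  one : num;
  plus : num -> num -> num;
  mult : num -> num -> num;
  exp : num -> num -> num;
  lt : num -> num -> Prop;
  set : Type;
  mem : num -> set -> Prop
}.
Arguments zero {s}.
Arguments one {s}.
Arguments plus {s}.
Arguments mult {s}.
Arguments exp {s}.
Arguments lt {s}.
Arguments mem {s}.

Fixpoint eval {M : structure} (e : nat -> num M) (t : term) : num M :=
  match t with
  | Var x => e x
  | Zero => zero
  | One => one
  | Plus a b => plus (eval e a) (eval e b)
  | Mult a b => mult (eval e a) (eval e b)
  | Exp a b => exp (eval e a) (eval e b)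
  end.

Fixpoint sat {M : structure} (e : nat -> num M) (E : nat -> set M) (A : form) : Prop :=
  match A with
  | Eq t u => eval e t = eval e u
  | Lt t u => lt (eval e t) (eval e u)
  | Mem t X => mem (eval e t) (E X)
  | Bot => False
  | Imp A B => sat e E A -> sat e E B
  | And A B => sat e E A /\ sat e E B
  | Or A B => sat e E A \/ sat e E B
  | AllNum A => forall x, sat (scons x e) E A
  | ExNum A => exists x, sat (scons x e) E A
  | AllSet A => forall X, sat e (scons X E) A
  | ExSet A => exists X, sat e (scons X E) A
  end.

Lemma eval_subst M (e : nat -> num M) s t :
  eval e (subst_term s t) = eval (fun n => eval e (s n)) t.
Proof. induction t; simpl; congruence. Qed.

Lemma eval_shift M (e : nat -> num M) k t : eval e (shift k t) = eval (fun n => e (k + n)) t.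
Proof. unfold shift. now rewrite eval_subst. Qed.

Lemma sat_subst M (e : nat -> num M) E s r A :
  sat e E (subst s r A) <-> sat (fun n => eval e (s n)) (fun X => E (r X)) A.
Proof.
  revert e E s r; induction A; intros e E s0 r; simpl; rewrite ?eval_subst; try tauto.
  1,2,3: rewrite IHA1, IHA2; tauto.
  1,2: assert (up : forall x, (fun n => eval (scons x e) (up_num s0 n))
                            = scons x (fun n => eval e (s0 n)))
    by (intros x; extensionality n; destruct n; simpl; now rewrite ?eval_shift);
    setoid_rewrite IHA; setoid_rewrite up; tauto.
  1,2: assert (up : forall X, (fun n => scons X E (up_set r n))
                            = scons X (fun n => E (r n)))
    by (intros x; extensionality n; now destruct n);
    setoid_rewrite IHA; setoid_rewrite up; tauto.
Qed.

(** ** Completeness *)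

(** What matters is injectivity: the codes serve to run through all formulas in the Henkin
    construction. *)
Fixpoint code_term (t : term) : nat :=
  match t with
  | Var x => to_nat (0, x)
  | Zero => to_nat (1, 0)
  | One => to_nat (2, 0)
  | Plus a b => to_nat (3, to_nat (code_term a, code_term b))
  | Mult a b => to_nat (4, to_nat (code_term a, code_term b))
  | Exp a b => to_nat (5, to_nat (code_term a, code_term b))
  end.

Fixpoint code (A : form) : nat :=
  match A with
  | Eq t u => to_nat (0, to_nat (code_term t, code_term u))
  | Lt t u => to_nat (1, to_nat (code_term t, code_term u))
  | Mem t X => to_nat (2, to_nat (code_term t, X))
  | Bot => to_nat (3, 0)
  | Imp A B => to_nat (4, to_nat (code A, code B))
  | And A B => to_nat (5, to_nat (code A, code B))
  | Or A B => to_nat (6, to_nat (code A, code B))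
  | AllNum A => to_nat (7, code A)
  | ExNum A => to_nat (8, code A)
  | AllSet A => to_nat (9, code A)
  | ExSet A => to_nat (10, code A)
  end.

#[local] Opaque to_nat.

Lemma code_term_inj t u : code_term t = code_term u -> t = u.
Proof.
  revert u; induction t; intros []; cbn [code_term]; intros H;
    try reflexivity; apply to_nat_inj in H; try discriminate; injection H as H;
    try apply to_nat_inj in H; try injection H as H H'; f_equal; auto.
Qed.

Lemma code_inj A B : code A = code B -> A = B.
Proof.
  revert B; induction A; intros []; cbn [code]; intros H;
    try reflexivity; apply to_nat_inj in H; try discriminate; injection H as H;
    try apply to_nat_inj in H; try injection H as H H'; f_equal; auto using code_term_inj.
Qed.

(** * Extension to a complete theory with witnesses *)

Section Henkin.
Context (T : form -> Prop) (G0 : list form).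
Hypothesis G0_consistent : ~ proves T G0 Bot.

Definition fresh (L : list form) : nat :=
  epsilon (inhabits 0) (fun N => forall A, In A L -> free_below N A).

Lemma fresh_spec L A : In A L -> free_below (fresh L) A.
Proof. exact (epsilon_spec (inhabits 0) _ (free_below_list L) A). Qed.

Definition witness (G : list form) (A : form) : list form :=
  match A with
  | ExNum B => [instN (Var (fresh (B :: G))) B]
  | ExSet B => [instS (fresh (B :: G)) B]
  | _ => []
  end.

Definition extend (G : list form) (A : form) : list form :=
  if excluded_middle_informative (proves T (A :: G) Bot) then G
  else witness (A :: G) A ++ A :: G.

Lemma extend_incl G A : incl G (extend G A).
Proof.
  unfold extend. destruct excluded_middle_informative; [apply incl_refl|].
  apply incl_appr, incl_tl, incl_refl.
Qed.

(** The substitution [s] renames the fresh variable to 0 and shifts the variables below it, which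
    turns the refutation of the witness into the eigenvariable premise of [pr_exNE]. *)
Lemma fresh_witnessN G B :
  In (ExNum B) G -> proves T (instN (Var (fresh (B :: G))) B :: G) Bot -> proves T G Bot.
Proof.
  intros HG H. set (N := fresh (B :: G)) in *.
  set (s := fun k => if k <? N then Var (S k) else Var 0).
  assert (s_lt : forall k, k < N -> s k = Var (S k)).
  { intros k Hk. unfold s. now apply Nat.ltb_lt in Hk as ->. }
  assert (s_N : s N = Var 0). { unfold s. now rewrite Nat.ltb_irrefl. }
  apply proves_subst with (s := s) (r := fun X => X) in H. simpl in H.
  apply pr_exNE with B; [apply pr_hyp, HG|].
  replace (map shiftN G) with (map (subst s (fun X => X)) G).
  2: { apply map_ext_in. intros A HA. apply (fresh_spec (B :: G)); [now right|auto..]. }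
  replace B with (subst s (fun X => X) (instN (Var N) B)) at 1; [exact H|].
  unfold instN. rewrite subst_comp. rewrite <- (subst_id B) at 2.
  apply (fresh_spec (B :: G)); [now left| |auto].
  intros [|k] Hk; simpl; [exact s_N|apply s_lt]. fold N in Hk. lia.
Qed.

Lemma fresh_witnessS G B :
  In (ExSet B) G -> proves T (instS (fresh (B :: G)) B :: G) Bot -> proves T G Bot.
Proof.
  intros HG H. set (N := fresh (B :: G)) in *.
  set (r := fun k => if k <? N then S k else 0).
  assert (r_lt : forall k, k < N -> r k = S k).
  { intros k Hk. unfold r. now apply Nat.ltb_lt in Hk as ->. }
  assert (r_N : r N = 0). { unfold r. now rewrite Nat.ltb_irrefl. }
  apply proves_subst with (s := Var) (r := r) in H. simpl in H.
  apply pr_exSE with B; [apply pr_hyp, HG|].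
  replace (map shiftS G) with (map (subst Var r) G).
  2: { apply map_ext_in. intros A HA. apply (fresh_spec (B :: G)); [now right|auto..]. }
  replace B with (subst Var r (instS N B)) at 1; [exact H|].
  unfold instS. rewrite subst_comp. rewrite <- (subst_id B) at 2.
  apply (fresh_spec (B :: G)); [now left|auto|].
  intros [|k] Hk; simpl; [exact r_N|apply r_lt]. fold N in Hk. lia.
Qed.

Lemma extend_consistent G A : ~ proves T G Bot -> ~ proves T (extend G A) Bot.
Proof.
  intros HG. unfold extend. destruct excluded_middle_informative as [|HA]; [exact HG|].
  intros H. apply HA. destruct A; try exact H.
  - now apply fresh_witnessN in H; [|left].
  - now apply fresh_witnessS in H; [|left].
Qed.

Definition nth_form (n : nat) : form := epsilon (inhabits Bot) (fun A => code A = n).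

Lemma nth_form_code A : nth_form (code A) = A.
Proof.
  apply code_inj. unfold nth_form.
  exact (epsilon_spec (inhabits Bot) (fun B => code B = code A) (ex_intro _ A eq_refl)).
Qed.

Fixpoint stage (n : nat) : list form :=
  match n with 0 => G0 | S n => extend (stage n) (nth_form n) end.

Lemma stage_incl m n : m <= n -> incl (stage m) (stage n).
Proof.
  induction 1; [apply incl_refl|]. eapply incl_tran; [eassumption|apply extend_incl].
Qed.

Lemma stage_consistent n : ~ proves T (stage n) Bot.
Proof. induction n; [exact G0_consistent|now apply extend_consistent]. Qed.

(** The deductive closure of the union of all stages. Stages increase, so finitely many theorems are
    always derivable at a common stage. *)
Definition Th (A : form) : Prop := exists n, proves T (stage n) A.

Lemma Th_cut A B : (forall G, proves T G A -> proves T G B) -> Th A -> Th B.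
Proof. intros H [n Hn]. exists n. auto. Qed.

Lemma Th_cut2 A B C :
  (forall G, proves T G A -> proves T G B -> proves T G C) -> Th A -> Th B -> Th C.
Proof.
  intros H [m Hm] [n Hn]. exists (m + n).
  apply H; eapply weakening; try eassumption; apply stage_incl; lia.
Qed.

Lemma Th_pure A : (forall G, proves T G A) -> Th A.
Proof. intros H. exists 0. auto. Qed.

Lemma Th_Bot : ~ Th Bot.
Proof. intros [n Hn]. exact (stage_consistent n Hn). Qed.

(** Each formula is decided at the stage given by its own code: it is added there unless that stage
    refutes it. *)
Lemma Th_Not A : ~ Th A -> Th (Not A).
Proof.
  intros H. set (n := code A).
  destruct (classic (proves T (A :: stage n) Bot)) as [HA|HA].
  - exists n. now apply pr_impI.
  - exfalso. apply H. exists (S n). apply pr_hyp. simpl.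
    unfold n. rewrite nth_form_code. unfold extend.
    destruct excluded_middle_informative as [|_]; [contradiction|].
    apply in_or_app. right. now left.
Qed.

(** No stage refutes a theorem of the consistent [Th], so [A] is accepted at its own stage, and its
    witness enters with it. *)
Lemma Th_extended A : Th A -> incl (witness (A :: stage (code A)) A) (stage (S (code A))).
Proof.
  intros HA. simpl. rewrite nth_form_code. unfold extend.
  destruct excluded_middle_informative as [H|_]; [|apply incl_appl, incl_refl].
  exfalso. apply Th_Bot. apply (Th_cut2 (Not A) A); [intros G; apply pr_impE| |exact HA].
  exists (code A). now apply pr_impI.
Qed.

Lemma Th_ExNum B : Th (ExNum B) <-> exists t, Th (instN t B).
Proof.
  split; [|intros [t Ht]; revert Ht; apply Th_cut; intros G; apply pr_exNI].
  intros H. apply Th_extended in H. eexists. eexists. apply pr_hyp, H. now left.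
Qed.

Lemma Th_ExSet B : Th (ExSet B) <-> exists Y, Th (instS Y B).
Proof.
  split; [|intros [t Ht]; revert Ht; apply Th_cut; intros G; apply pr_exSI].
  intros H. apply Th_extended in H. eexists. eexists. apply pr_hyp, H. now left.
Qed.

Lemma Th_Not_iff A : Th (Not A) <-> ~ Th A.
Proof.
  split; [|apply Th_Not]. intros H1 H2. apply Th_Bot. revert H1 H2.
  apply Th_cut2. intros G. apply pr_impE.
Qed.

Lemma Th_And A B : Th (A ⩑ B) <-> Th A /\ Th B.
Proof.
  split.
  - intros H. split; revert H; apply Th_cut; intros G;
      [apply pr_andE1|apply pr_andE2].
  - intros [HA HB]. revert HA HB. apply Th_cut2. intros G. apply pr_andI.
Qed.

Lemma Th_Imp A B : Th (A ⟶ B) <-> (Th A -> Th B).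
Proof.
  split; [intros H1 H2; revert H1 H2; apply Th_cut2; intros G; apply pr_impE|].
  intros H. destruct (classic (Th A)) as [HA|HA].
  - apply H in HA. revert HA. apply Th_cut. intros G HB. apply pr_impI.
    eapply weakening; [eassumption|apply incl_tl, incl_refl].
  - apply Th_Not in HA. revert HA. apply Th_cut. intros G HA. apply pr_impI, pr_raa.
    apply pr_impE with A; [|apply pr_hyp; simpl; tauto].
    eapply weakening; [eassumption|apply incl_tl, incl_tl, incl_refl].
Qed.

Lemma Th_Or A B : Th (A ⩒ B) <-> Th A \/ Th B.
Proof.
  split.
  - intros H. apply NNPP. intros HN. apply Th_Bot.
    assert (HA : Th (Not A)) by (apply Th_Not; tauto).
    assert (HB : Th (Not B)) by (apply Th_Not; tauto).
    assert (HAB : Th (Not A ⩑ Not B)) by now apply Th_And.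
    revert H HAB. apply Th_cut2. intros G H HAB.
    apply pr_orE with A B; [exact H|..]; eapply pr_impE;
      try (apply pr_hyp; now left);
      eapply weakening with G; try apply incl_tl, incl_refl;
      [eapply pr_andE1|eapply pr_andE2]; eassumption.
  - intros [H|H]; revert H; apply Th_cut; intros G; [apply pr_orI1|apply pr_orI2].
Qed.

(** By duality: if the universal formula fails, [ExNum (Not B)] is a theorem, and its Henkin witness
    is a counterexample among the instances. *)
Lemma Th_AllNum B : Th (AllNum B) <-> forall t, Th (instN t B).
Proof.
  split; [intros H t; revert H; apply Th_cut; intros G; apply pr_allNE|].
  intros H. apply NNPP. intros HB. apply Th_Not in HB.
  assert (HE : Th (ExNum (Not B))).
  { revert HB. apply Th_cut. intros G HB. apply pr_raa.
    apply pr_impE with (AllNum B);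
      [eapply weakening; [exact HB|apply incl_tl, incl_refl]|].
    apply pr_allNI, pr_raa. eapply pr_impE; [apply pr_hyp; right; now left|].
    apply pr_exNI with (Var 0).
    change (proves T (Not B :: shiftN (Not (ExNum (Not B))) :: map shiftN G)
     (instN (Var 0) (subst (up_num (fun n => Var (S n))) (fun X => X) (Not B)))).
    rewrite instN_subst, scons_eta, subst_id. apply pr_hyp. now left. }
  apply Th_ExNum in HE as [t Ht]. apply Th_Not_iff in Ht. apply Ht, H.
Qed.

Lemma Th_AllSet B : Th (AllSet B) <-> forall Y, Th (instS Y B).
Proof.
  split; [intros H t; revert H; apply Th_cut; intros G; apply pr_allSE|].
  intros H. apply NNPP. intros HB. apply Th_Not in HB.
  assert (HE : Th (ExSet (Not B))).
  { revert HB. apply Th_cut. intros G HB. apply pr_raa.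
    apply pr_impE with (AllSet B);
      [eapply weakening; [exact HB|apply incl_tl, incl_refl]|].
    apply pr_allSI, pr_raa. eapply pr_impE; [apply pr_hyp; right; now left|].
    apply pr_exSI with 0.
    change (proves T (Not B :: shiftS (Not (ExSet (Not B))) :: map shiftS G)
     (instS 0 (subst Var (up_set S) (Not B)))).
    rewrite instS_subst.
    replace (scons 0 S) with (fun X : nat => X) by (extensionality n; now destruct n).
    rewrite subst_id. apply pr_hyp. now left. }
  apply Th_ExSet in HE as [t Ht]. apply Th_Not_iff in Ht. apply Ht, H.
Qed.

(** * The term model *)

Definition teq (t u : term) : Prop := Th (t ≐ u).

Lemma Th_eq_subst A t u : teq t u -> Th (instN t A) -> Th (instN u A).
Proof. apply Th_cut2. intros G. apply pr_eq_subst. Qed.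

Lemma teq_refl t : teq t t.
Proof. apply Th_pure. intros G. apply pr_eq_refl. Qed.

Lemma instN_shift t u : subst_term (scons t Var) (shift 1 u) = u.
Proof. now rewrite subst_term_scons_shift, subst_term_id. Qed.

Lemma teq_sym t u : teq t u -> teq u t.
Proof.
  intros H. pose proof (Th_eq_subst (Var 0 ≐ shift 1 t) t u H) as H'.
  unfold instN in H'. cbn [subst subst_term scons] in H'. rewrite !instN_shift in H'.
  apply H', teq_refl.
Qed.

Lemma teq_trans t u v : teq t u -> teq u v -> teq t v.
Proof.
  intros H1 H2. pose proof (Th_eq_subst (shift 1 t ≐ Var 0) u v H2) as H'.
  unfold instN in H'. cbn [subst subst_term scons] in H'. rewrite !instN_shift in H'.
  apply H', H1.
Qed.

Lemma teq_context C t u :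
  teq t u -> teq (subst_term (scons t Var) C) (subst_term (scons u Var) C).
Proof.
  intros H. pose proof (Th_eq_subst (shift 1 (subst_term (scons t Var) C) ≐ C) t u H) as H'.
  unfold instN in H'. cbn [subst] in H'. rewrite !instN_shift in H'.
  apply H', teq_refl.
Qed.

Lemma teq_binary (f : term -> term -> term) t t' u u' :
  (forall s a b, subst_term s (f a b) = f (subst_term s a) (subst_term s b)) ->
  teq t t' -> teq u u' -> teq (f t u) (f t' u').
Proof.
  intros Hf H1 H2. apply teq_trans with (f t' u).
  - pose proof (teq_context (f (Var 0) (shift 1 u)) t t' H1) as H.
    rewrite !Hf, !instN_shift in H. exact H.
  - pose proof (teq_context (f (shift 1 t') (Var 0)) u u' H2) as H.
    rewrite !Hf, !instN_shift in H. exact H.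
Qed.

(** A chosen representative of each class realizes the quotient of the terms by [teq] as the subtype
    of fixed points of [rep]. *)
Definition rep (t : term) : term := epsilon (inhabits Zero) (teq t).

Lemma teq_rep t : teq t (rep t).
Proof. apply (epsilon_spec (inhabits Zero) (teq t)). exists t. apply teq_refl. Qed.

Lemma rep_eq t u : teq t u -> rep t = rep u.
Proof.
  intros H. unfold rep. f_equal. extensionality v. apply propositional_extensionality.
  split; intros H'; [apply teq_sym in H|]; eapply teq_trans; eassumption.
Qed.

Definition cls (t : term) : {t | rep t = t} :=
  exist _ (rep t) (eq_sym (rep_eq t (rep t) (teq_rep t))).

Lemma cls_eq t u : cls t = cls u <-> teq t u.
Proof.
  split.
  - intros H. injection H as H. apply teq_trans with (rep t); [apply teq_rep|].
    rewrite H. apply teq_sym, teq_rep.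
  - intros H. unfold cls. apply eq_sig_hprop; [intros; apply proof_irrelevance|].
    now apply rep_eq.
Qed.

Lemma cls_surj (x : {t | rep t = t}) : x = cls (proj1_sig x).
Proof.
  apply eq_sig_hprop; [intros; apply proof_irrelevance|].
  destruct x as [t Ht]. simpl. congruence.
Qed.

(** Set variables themselves serve as sets: the language has no equality between sets, hence no
    quotient is taken there. *)
Definition henkin : structure := {|
  num := {t | rep t = t};
  zero := cls Zero;
  one := cls One;
  plus a b := cls (Plus (proj1_sig a) (proj1_sig b));
  mult a b := cls (Mult (proj1_sig a) (proj1_sig b));
  exp a b := cls (Exp (proj1_sig a) (proj1_sig b));
  lt a b := Th (proj1_sig a ≺ proj1_sig b);
  set := nat;
  mem a X := Th (proj1_sig a ∈ X)
|}.

Lemma eval_henkin s t : eval (M := henkin) (fun n => cls (s n)) t = cls (subst_term s t).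
Proof.
  induction t as [| | |a IHa b IHb|a IHa b IHb|a IHa b IHb]; try reflexivity;
    simpl; rewrite IHa, IHb; apply cls_eq; apply teq_binary; try reflexivity;
    apply teq_sym, teq_rep.
Qed.

Lemma Th_rep A t : Th (instN (rep t) A) <-> Th (instN t A).
Proof. split; apply Th_eq_subst; [apply teq_sym|]; apply teq_rep. Qed.

(** Stated for all [s] and [r], so that a quantifier merely extends the substitution and the
    induction hypothesis applies to its body. *)
Lemma truth A s r :
  sat (M := henkin) (fun n => cls (s n)) r A <-> Th (subst s r A).
Proof.
  assert (sconsN : forall x s, scons (X := num henkin) x (fun n => cls (s n))
    = fun n => cls (scons (proj1_sig x) s n)).
  { intros x s0. extensionality n. destruct n; [apply cls_surj|reflexivity]. }
  revert s r; induction A as [t u|t u|t X| |A IHA B IHB|A IHA B IHB|A IHA B IHB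
    |A IHA|A IHA|A IHA|A IHA]; intros s r; simpl.
  - rewrite !eval_henkin. apply cls_eq.
  - rewrite !eval_henkin. simpl. set (a := subst_term s t). set (b := subst_term s u).
    pose proof (Th_rep (Var 0 ≺ shift 1 (rep b)) a) as H1.
    pose proof (Th_rep (shift 1 a ≺ Var 0) b) as H2.
    unfold instN in H1, H2. cbn [subst subst_term scons] in H1, H2.
    rewrite !instN_shift in H1, H2. now rewrite H1, H2.
  - rewrite !eval_henkin. apply (Th_rep (Var 0 ∈ r X)).
  - split; [tauto|apply Th_Bot].
  - rewrite IHA, IHB. symmetry. apply Th_Imp.
  - rewrite IHA, IHB. symmetry. apply Th_And.
  - rewrite IHA, IHB. symmetry. apply Th_Or.
  - rewrite Th_AllNum. split.
    + intros H t. rewrite instN_subst. apply IHA.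
      (* The model quantifies over representatives only; an arbitrary [t] is reached through its
         class, and [Th_rep] replaces the representative by [t]. *)
      specialize (H (cls t)). rewrite sconsN in H. apply IHA in H.
      apply IHA. revert H. rewrite <- !(instN_subst _ s). apply Th_rep.
    + intros H x. rewrite sconsN. apply IHA. rewrite <- instN_subst. apply H.
  - rewrite Th_ExNum. split.
    + intros [x H]. rewrite sconsN in H. apply IHA in H. rewrite <- instN_subst in H.
      now exists (proj1_sig x).
    + intros [t H]. exists (cls t). rewrite sconsN. apply IHA. rewrite <- instN_subst.
      now apply Th_rep.
  - rewrite Th_AllSet. split.
    + intros H Y. rewrite instS_subst. apply IHA, H.
    + intros H Y. apply IHA. rewrite <- instS_subst. apply H.
  - rewrite Th_ExSet. split.
    + intros [Y H]. exists Y. rewrite instS_subst. apply IHA, H.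
    + intros [Y H]. exists Y. apply IHA. rewrite <- instS_subst. apply H.
Qed.

Lemma henkin_model A e E : T A -> sat (M := henkin) e E A.
Proof.
  intros HA. replace e with (fun n => cls (proj1_sig (e n)))
    by (extensionality n; symmetry; apply cls_surj).
  apply truth. apply Th_pure. intros G. apply weakening with []; [|intros ? []].
  now apply proves_subst_nil, pr_ax.
Qed.

End Henkin.

Theorem completeness (T : form -> Prop) (A : form) :
  (forall (M : structure), (forall B e E, T B -> sat (M := M) e E B) ->
   forall e E, sat (M := M) e E A) ->
  proves T [] A.
Proof.
  intros H. apply pr_raa. apply NNPP. intros HC.
  specialize (H (henkin T _) (henkin_model T _ HC) (fun n => cls T [Not A] (Var n)) (fun X => X)).
  apply (truth T _ HC) in H. rewrite subst_id in H.
  apply (Th_Bot T _ HC).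
  apply (Th_cut2 T _ (Not A) A); [intros G; apply pr_impE| |exact H].
  exists 0. apply pr_hyp. now left.
Qed.

(** * Arithmetic in a model of RCA_0^* *)

Lemma sigma00_subst A s r : sigma00 A -> sigma00 (subst s r A).
Proof.
  intros HA. revert s. induction HA; intros s0; simpl; try (constructor; auto; fail).
  - replace (subst_term (up_num s0) (shift 1 t)) with (shift 1 (subst_term s0 t));
      [now constructor|].
    unfold up_num. rewrite subst_term_scons_shift. unfold shift.
    now rewrite subst_term_comp.
  - replace (subst_term (up_num s0) (shift 1 t)) with (shift 1 (subst_term s0 t));
      [now constructor|].
    unfold up_num. rewrite subst_term_scons_shift. unfold shift.
    now rewrite subst_term_comp.
Qed.

Declare Scope num_scope.
Delimit Scope num_scope with num.
Bind Scope num_scope with num.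
Infix "+" := plus : num_scope.
Infix "*" := mult : num_scope.
Infix "^" := exp : num_scope.
Infix "<" := lt : num_scope.
Notation "0" := zero : num_scope.
Notation "1" := one : num_scope.

Definition le {M : structure} (x y : num M) : Prop := lt x y \/ x = y.
Infix "<=" := le : num_scope.

Section Model.
Context (M : structure).
Hypothesis HM : forall A (e : nat -> num M) E, RCA0star A -> sat e E A.
(** An arbitrary set that fills the oracle place whenever a predicate mentions numbers only. As
    colorings are coded by numbers, this covers the whole combinatorial part. *)
Context (X0 : set M).
Local Open Scope num_scope.
Local Notation D := (num M).
Local Notation env := (nat -> D).
Implicit Types (e : env) (x y z : D).

(** ** Definability by Sigma^0_0 formulas with number parameters and a set oracle *)

(** The variables of a formula are instantiated either by coordinates of the
    environment or by parameters. *)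
Definition look (g : nat -> nat + D) e : env :=
  fun n => match g n with inl k => e k | inr p => p end.

Definition tl e : env := fun n => e (S n).

(** Definability is a property of predicates on environments, closed under connectives and bounded
    quantifiers, so that instances of the schemes are obtained without writing formulas. A single
    oracle suffices: at each use it is the given coloring, the given enumeration, or arbitrary. *)
Definition definable X (P : env -> Prop) : Prop :=
  exists A g, sigma00 A /\ forall e, P e <-> sat (look g e) (fun _ => X) A.

Definition term_fun (f : env -> D) : Prop :=
  exists t g, forall e, f e = eval (look g e) t.

(** Two formulas receive a common assignment by moving the variables of one to even and those of the
    other to odd indices. *)
Definition merge (g g' : nat -> nat + D) (n : nat) : nat + D :=
  if Nat.even n then g (Nat.div2 n) else g' (Nat.div2 n).

Lemma look_merge_l g g' e : (fun n => look (merge g g') e (2 * n)%nat) = look g e.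
Proof.
  extensionality n. unfold look, merge. rewrite Nat.even_mul. cbn [orb Nat.even].
  now rewrite Nat.div2_double.
Qed.

Lemma look_merge_r g g' e : (fun n => look (merge g g') e (S (2 * n))) = look g' e.
Proof.
  extensionality n. unfold look, merge. rewrite Nat.even_succ, Nat.odd_mul.
  cbn [Nat.odd Nat.even negb andb]. now rewrite Nat.div2_succ_double.
Qed.

Lemma merge_formulas X P Q :
  definable X P -> definable X Q ->
  exists A B g, sigma00 A /\ sigma00 B /\
    (forall e, P e <-> sat (look g e) (fun _ => X) A) /\
    (forall e, Q e <-> sat (look g e) (fun _ => X) B).
Proof.
  intros (A & g & HA & HP) (B & g' & HB & HQ).
  exists (subst (fun n => Var (2 * n)) (fun X => X) A),
    (subst (fun n => Var (S (2 * n))) (fun X => X) B), (merge g g').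
  split; [now apply sigma00_subst|]. split; [now apply sigma00_subst|].
  split; intros e; rewrite sat_subst; cbn [eval].
  - now rewrite look_merge_l.
  - now rewrite look_merge_r.
Qed.

Lemma merge_terms f f' :
  term_fun f -> term_fun f' ->
  exists t t' g, forall e, f e = eval (look g e) t /\ f' e = eval (look g e) t'.
Proof.
  intros (A & g & HP) (B & g' & HQ).
  exists (subst_term (fun n => Var (2 * n)) A),
    (subst_term (fun n => Var (S (2 * n))) B), (merge g g').
  intros e; rewrite !eval_subst; cbn [eval].
  now rewrite look_merge_l, look_merge_r.
Qed.

Lemma term_var k : term_fun (fun e => e k).
Proof. now exists (Var 0), (fun _ => inl k). Qed.

Lemma term_const p : term_fun (fun _ => p).
Proof. now exists (Var 0), (fun _ => inr p). Qed.

Lemma term_plus f g : term_fun f -> term_fun g -> term_fun (fun e => f e + g e).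
Proof.
  intros Hf Hg. destruct (merge_terms f g Hf Hg) as (t & t' & h & H).
  exists (Plus t t'), h. intros e. destruct (H e) as [-> ->]. reflexivity.
Qed.

Lemma term_mult f g : term_fun f -> term_fun g -> term_fun (fun e => f e * g e).
Proof.
  intros Hf Hg. destruct (merge_terms f g Hf Hg) as (t & t' & h & H).
  exists (Mult t t'), h. intros e. destruct (H e) as [-> ->]. reflexivity.
Qed.

Lemma term_exp f g : term_fun f -> term_fun g -> term_fun (fun e => f e ^ g e).
Proof.
  intros Hf Hg. destruct (merge_terms f g Hf Hg) as (t & t' & h & H).
  exists (Exp t t'), h. intros e. destruct (H e) as [-> ->]. reflexivity.
Qed.

Lemma definable_ext X (P Q : env -> Prop) :
  (forall e, P e <-> Q e) -> definable X P -> definable X Q.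
Proof.
  intros H (A & g & HA & HP). exists A, g. split; [exact HA|].
  intros e. now rewrite <- H.
Qed.

Lemma definable_eq_term X f g :
  term_fun f -> term_fun g -> definable X (fun e => f e = g e).
Proof.
  intros Hf Hg. destruct (merge_terms f g Hf Hg) as (t & t' & h & H).
  exists (t ≐ t'), h. split; [constructor|]. intros e. destruct (H e) as [-> ->]. reflexivity.
Qed.

Lemma definable_lt_term X f g :
  term_fun f -> term_fun g -> definable X (fun e => f e < g e).
Proof.
  intros Hf Hg. destruct (merge_terms f g Hf Hg) as (t & t' & h & H).
  exists (t ≺ t'), h. split; [constructor|]. intros e. destruct (H e) as [-> ->]. reflexivity.
Qed.

Lemma definable_mem_var X k : definable X (fun e => mem (e k) X).
Proof. exists (Var 0 ∈ 0), (fun _ => inl k). split; [constructor|reflexivity]. Qed.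

Lemma definable_False X : definable X (fun _ => False).
Proof. exists Bot, (fun _ => inl 0%nat). split; [constructor|reflexivity]. Qed.

Lemma definable_and X P Q :
  definable X P -> definable X Q -> definable X (fun e => P e /\ Q e).
Proof.
  intros HP HQ. destruct (merge_formulas X P Q HP HQ) as (A & B & g & HA & HB & HPA & HQB).
  exists (A ⩑ B), g. split; [now constructor|]. intros e. now rewrite HPA, HQB.
Qed.

Lemma definable_or X P Q :
  definable X P -> definable X Q -> definable X (fun e => P e \/ Q e).
Proof.
  intros HP HQ. destruct (merge_formulas X P Q HP HQ) as (A & B & g & HA & HB & HPA & HQB).
  exists (A ⩒ B), g. split; [now constructor|]. intros e. now rewrite HPA, HQB.
Qed.

Lemma definable_imp X P Q :
  definable X P -> definable X Q -> definable X (fun e => P e -> Q e).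
Proof.
  intros HP HQ. destruct (merge_formulas X P Q HP HQ) as (A & B & g & HA & HB & HPA & HQB).
  exists (A ⟶ B), g. split; [now constructor|]. intros e. now rewrite HPA, HQB.
Qed.

Lemma definable_not X P : definable X P -> definable X (fun e => ~ P e).
Proof. intros HP. apply definable_imp; [exact HP|apply definable_False]. Qed.

Lemma definable_iff X P Q :
  definable X P -> definable X Q -> definable X (fun e => P e <-> Q e).
Proof. intros HP HQ. apply definable_and; now apply definable_imp. Qed.

Lemma definable_rename X P (r : nat -> nat) :
  definable X P -> definable X (fun e => P (fun n => e (r n))).
Proof.
  intros (A & g & HA & HP).
  exists A, (fun n => match g n with inl k => inl (r k) | inr p => inr p end).
  split; [exact HA|]. intros e. rewrite HP.
  replace (look g (fun n => e (r n))) with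
    (look (fun n => match g n with inl k => inl (r k) | inr p => inr p end) e); [tauto|].
  extensionality n. unfold look. now destruct (g n).
Qed.

Lemma term_rename f (r : nat -> nat) : term_fun f -> term_fun (fun e => f (fun n => e (r n))).
Proof.
  intros (t & g & Hf).
  exists t, (fun n => match g n with inl k => inl (r k) | inr p => inr p end).
  intros e. rewrite Hf. f_equal.
  extensionality n. unfold look. now destruct (g n).
Qed.

(** Brings the coordinate bound by a quantifier to [Var 0]. *)
Lemma definable_body X P :
  definable X P ->
  exists A g, sigma00 A /\ forall e x,
    P (scons x e) <-> sat (scons x (look g e)) (fun _ => X) A.
Proof.
  intros (A & g & HA & HP).
  exists (subst (fun n => match g n with inl 0%nat => Var 0 | _ => Var (S n) end) (fun X => X) A).
  exists (fun n => match g n with inl (S k) => inl k | s => s end).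
  split; [now apply sigma00_subst|]. intros e x. rewrite sat_subst, HP.
  match goal with |- sat ?e _ _ <-> sat ?e' _ _ => replace e with e'; [tauto|] end.
  extensionality n. unfold look. destruct (g n) as [[|k]|p] eqn:Hg; simpl; rewrite ?Hg; auto.
Qed.

Lemma merge_bounded X f P :
  term_fun f -> definable X P ->
  exists t A g, sigma00 A /\ forall e, f e = eval (look g e) t /\
    forall x, P (scons x e) <-> sat (scons x (look g e)) (fun _ => X) A.
Proof.
  intros (t & g & Hf) HP. destruct (definable_body X P HP) as (A & g' & HA & HPA).
  exists (subst_term (fun n => Var (2 * n)) t),
    (subst (up_num (fun n => Var (S (2 * n)))) (fun X => X) A), (merge g g').
  split; [now apply sigma00_subst|]. intros e. split.
  - rewrite eval_subst. cbn [eval]. now rewrite look_merge_l.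
  - intros x. rewrite sat_subst, HPA.
    match goal with |- sat ?e _ _ <-> sat ?e' _ _ => replace e' with e; [tauto|] end.
    extensionality n. destruct n as [|n]; [reflexivity|].
    exact (f_equal (fun h => h n) (eq_sym (look_merge_r g g' e))).
Qed.

Lemma definable_ex_term X f (Q : env -> D -> Prop) :
  term_fun f -> definable X (fun e => Q (fun n => e (S n)) (e 0%nat)) ->
  definable X (fun e => exists x, x < f e /\ Q e x).
Proof.
  intros Hf HQ. destruct (merge_bounded X f _ Hf HQ) as (t & A & g & HA & H).
  exists (ExNum (Var 0 ≺ shift 1 t ⩑ A)), g. split; [now constructor|].
  intros e. destruct (H e) as [-> HP]. simpl. setoid_rewrite <- HP.
  setoid_rewrite eval_shift. reflexivity.
Qed.

Lemma definable_all_term X f (Q : env -> D -> Prop) :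
  term_fun f -> definable X (fun e => Q (fun n => e (S n)) (e 0%nat)) ->
  definable X (fun e => forall x, x < f e -> Q e x).
Proof.
  intros Hf HQ. destruct (merge_bounded X f _ Hf HQ) as (t & A & g & HA & H).
  exists (AllNum (Var 0 ≺ shift 1 t ⟶ A)), g. split; [now constructor|].
  intros e. destruct (H e) as [-> HP]. simpl. setoid_rewrite <- HP.
  setoid_rewrite eval_shift. reflexivity.
Qed.

Lemma induction X (P : D -> Prop) :
  definable X (fun e => P (e 0%nat)) ->
  P 0 -> (forall x, P x -> P (x + 1)) -> forall x, P x.
Proof.
  intros HP H0 HS. destruct (definable_body X _ HP) as (A & g & HA & HPA).
  set (e := look g (fun _ => 0)).
  assert (HP' : forall x, P x <-> sat (scons x e) (fun _ => X) A)
    by (intros x; apply (HPA (fun _ => 0))).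
  pose proof (HM _ e (fun _ => X) (ax_ind A HA)) as H. simpl in H. unfold instN in H.
  rewrite sat_subst in H. setoid_rewrite sat_subst in H.
  intros x. apply HP'. apply H. split.
  - replace (fun n => eval e (scons Zero Var n)) with (scons 0 e)
      by (extensionality n; now destruct n).
    now apply HP'.
  - intros y Hy.
    replace (fun n => eval (scons y e) (scons (Plus (Var 0) One) (fun n0 => Var (S n0)) n))
      with (scons (y + 1) e) by (extensionality n; now destruct n).
    now apply HP', HS, HP'.
Qed.

Lemma comprehension X (P : D -> Prop) :
  definable X (fun e => P (e 0%nat)) -> exists Y, forall x, mem x Y <-> P x.
Proof.
  intros HP. destruct (definable_body X _ HP) as (A & g & HA & HPA).
  set (e := look g (fun _ => 0)).
  assert (HP' : forall x, P x <-> sat (scons x e) (fun _ => X) A)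
    by (intros x; apply (HPA (fun _ => 0))).
  (* A dummy quantifier in front of [shiftN A] gives both a $\Sigma^0_1$ and a $\Pi^0_1$ form of the
     same predicate, so their equivalence is immediate. *)
  assert (HA' : sigma00 (shiftN A)) by now apply sigma00_subst.
  pose proof (HM _ e (fun _ => X) (ax_comp _ _ (s01 _ HA') (p01 _ HA'))) as H.
  assert (Hsat : forall y x E, sat (scons y (scons x e)) E (shiftN A)
    <-> sat (scons x e) E A).
  { intros y x E. unfold shiftN. now rewrite sat_subst. }
  simpl in H. setoid_rewrite Hsat in H. destruct H as [Y HY].
  { intros x. split; [intros [_ H]; auto|intros H; exists 0; apply (H 0)]. }
  exists Y. intros x. rewrite HP'. destruct (HY x) as [H1 H2].
  assert (HS : forall y, sat (scons y (scons x e)) (scons Y (fun _ => X))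
     (subst (up_num Var) S (shiftN A)) <-> sat (scons x e) (fun _ => X) A).
  { intros y. unfold shiftN. rewrite subst_comp, sat_subst.
    match goal with |- sat ?e1 _ _ <-> sat ?e2 _ _ => replace e1 with e2; [tauto|] end.
    extensionality n. now destruct n. }
  setoid_rewrite HS in H1. setoid_rewrite HS in H2. split.
  - intros Hx. now destruct (H1 Hx).
  - intros Hx. apply H2. now exists 0.
Qed.

Ltac term_definability :=
  repeat first
   [ lazymatch goal with
     | |- definable _ (fun e => _ -> False) => apply definable_not
     | |- definable _ (fun e => ~ _) => apply definable_not
     | |- definable _ (fun e => @?P e /\ @?Q e) => apply (definable_and _ P Q)
     | |- definable _ (fun e => @?P e \/ @?Q e) => apply (definable_or _ P Q)
     | |- definable _ (fun e => @?P e <-> @?Q e) => apply (definable_iff _ P Q)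
     | |- definable _ (fun e => exists x, x < @?f e /\ @?Q e x) =>
         apply (definable_ex_term _ f Q)
     | |- definable _ (fun e => forall x, x < @?f e -> @?Q e x) =>
         apply (definable_all_term _ f Q)
     | |- definable _ (fun e => @?P e -> @?Q e) => apply (definable_imp _ P Q)
     | |- definable _ (fun e => @?f e < @?g e) => apply (definable_lt_term _ f g)
     | |- definable _ (fun e => @?f e <= @?g e) =>
         apply (definable_or _ (fun e => f e < g e) (fun e => f e = g e))
     | |- definable _ (fun e => @?f e = @?g e) => apply (definable_eq_term _ f g)
     | |- term_fun (fun e => @?f e + @?g e) => apply (term_plus f g)
     | |- term_fun (fun e => @?f e * @?g e) => apply (term_mult f g)
     | |- term_fun (fun e => @?f e ^ @?g e) => apply (term_exp f g)
     | |- term_fun (fun e => e _) => apply term_var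
     | |- term_fun (fun _ => _) => apply term_const
     end; cbv beta ].

(** ** Basic laws *)

Lemma succ_neq_0 x : x + 1 <> 0.
Proof. exact (HM _ (fun _ => x) (fun _ => X0) ax_succ_nonzero). Qed.
Lemma succ_inj x y : x + 1 = y + 1 -> x = y.
Proof. exact (HM _ (scons x (fun _ => y)) (fun _ => X0) ax_succ_inj). Qed.
Lemma plus_0_r x : x + 0 = x.
Proof. exact (HM _ (fun _ => x) (fun _ => X0) ax_plus_zero). Qed.
Lemma plus_succ_r x y : x + (y + 1) = x + y + 1.
Proof. exact (HM _ (scons x (fun _ => y)) (fun _ => X0) ax_plus_succ). Qed.
Lemma mult_0_r x : x * 0 = 0.
Proof. exact (HM _ (fun _ => x) (fun _ => X0) ax_mult_zero). Qed.
Lemma mult_succ_r x y : x * (y + 1) = x * y + x.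
Proof. exact (HM _ (scons x (fun _ => y)) (fun _ => X0) ax_mult_succ). Qed.
Lemma nlt_0 x : ~ x < 0.
Proof. exact (HM _ (fun _ => x) (fun _ => X0) ax_lt_zero). Qed.
Lemma lt_succ x y : x < y + 1 <-> x <= y.
Proof. exact (HM _ (scons x (fun _ => y)) (fun _ => X0) ax_lt_succ). Qed.
Lemma exp_0_r x : x ^ 0 = 1.
Proof. exact (HM _ (fun _ => x) (fun _ => X0) ax_exp_zero). Qed.
Lemma exp_succ_r x y : x ^ (y + 1) = x * x ^ y.
Proof. exact (HM _ (scons x (fun _ => y)) (fun _ => X0) ax_exp_succ). Qed.

Ltac num_induction x :=
  pattern x; apply (induction X0); [term_definability| |clear x; intros x ?IH].

Lemma plus_assoc x y z : x + y + z = x + (y + z).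
Proof.
  num_induction z; [now rewrite !plus_0_r|]. now rewrite !plus_succ_r, IH.
Qed.

Lemma plus_0_l x : 0 + x = x.
Proof. num_induction x; [apply plus_0_r|]. now rewrite plus_succ_r, IH. Qed.

Lemma plus_succ_l x y : x + 1 + y = x + y + 1.
Proof. num_induction y; [now rewrite !plus_0_r|]. now rewrite !plus_succ_r, IH. Qed.

Lemma plus_comm x y : x + y = y + x.
Proof.
  num_induction y; [now rewrite plus_0_r, plus_0_l|]. now rewrite plus_succ_r, plus_succ_l, IH.
Qed.

Lemma mult_plus_r x y z : x * (y + z) = x * y + x * z.
Proof.
  num_induction z; [now rewrite mult_0_r, !plus_0_r|].
  now rewrite plus_succ_r, !mult_succ_r, IH, plus_assoc.
Qed.

Lemma mult_0_l x : 0 * x = 0.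
Proof. num_induction x; [apply mult_0_r|]. now rewrite mult_succ_r, IH, plus_0_r. Qed.

Lemma mult_1_r x : x * 1 = x.
Proof. now rewrite <- (plus_0_l 1), mult_succ_r, mult_0_r, plus_0_l. Qed.

Lemma mult_succ_l x y : (x + 1) * y = x * y + y.
Proof.
  num_induction y; [now rewrite !mult_0_r, plus_0_r|].
  rewrite !mult_succ_r, IH, !plus_assoc. f_equal.
  rewrite <- !plus_assoc. f_equal. apply plus_comm.
Qed.

Lemma mult_comm x y : x * y = y * x.
Proof.
  num_induction y; [now rewrite mult_0_r, mult_0_l|]. now rewrite mult_succ_r, mult_succ_l, IH.
Qed.

Lemma mult_assoc x y z : x * y * z = x * (y * z).
Proof.
  num_induction z; [now rewrite !mult_0_r|]. now rewrite !mult_succ_r, mult_plus_r, IH.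
Qed.

Lemma num_semi_ring : semi_ring_theory (0 : D) 1 plus mult eq.
Proof.
  constructor; intros; auto using plus_0_l, plus_comm, eq_sym, plus_assoc, mult_0_l,
    mult_comm, mult_assoc.
  - now rewrite mult_comm, mult_1_r.
  - now rewrite mult_comm, mult_plus_r, (mult_comm p n), (mult_comm p m).
Qed.

Add Ring num_ring : num_semi_ring.

(** ** Order *)

Lemma le_0_l x : 0 <= x.
Proof.
  num_induction x; [now right|]. left. apply lt_succ, IH.
Qed.

Lemma lt_exists x y : x < y <-> exists z, y = x + z + 1.
Proof.
  split.
  (* The witness is bounded by [y] to make the induction formula $\Sigma^0_0$. *)
  - intros H. cut (exists z, z < y /\ y = x + z + 1); [firstorder|]. revert H.
    num_induction y; [intros []%nlt_0|].
    intros [Hx| ->]%lt_succ.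
    + destruct (IH Hx) as (z & Hz & Hy). exists (z + 1). split.
      * rewrite Hy at 1. rewrite lt_succ.
        assert (Hw : forall w, z + 1 <= w + z + 1).
        { intros w. num_induction w; [right; ring|]. left.
          replace (w + 1 + z + 1) with (w + z + 1 + 1) by ring. now apply lt_succ. }
        apply Hw.
      * rewrite Hy at 1. ring.
    + exists 0. split; [apply lt_succ, le_0_l|ring].
  - intros [z ->]. num_induction z.
    + apply lt_succ. right. ring.
    + replace (x + (z + 1) + 1) with (x + z + 1 + 1) by ring. apply lt_succ. now left.
Qed.

Lemma le_exists x y : x <= y <-> exists z, y = x + z.
Proof.
  rewrite <- lt_succ, lt_exists. split; intros [z Hz]; exists z.
  - now apply succ_inj.
  - now rewrite Hz.
Qed.

Lemma plus_cancel_r x y z : x + z = y + z -> x = y.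
Proof.
  num_induction z; [now rewrite !plus_0_r|].
  rewrite !plus_succ_r. auto using succ_inj.
Qed.

Lemma plus_cancel_l x y z : z + x = z + y -> x = y.
Proof. rewrite !(plus_comm z). apply plus_cancel_r. Qed.

Lemma lt_irrefl x : ~ x < x.
Proof.
  intros [z Hz]%lt_exists. apply (succ_neq_0 z), (plus_cancel_l _ _ x).
  rewrite plus_0_r. transitivity (x + z + 1); [ring|now symmetry].
Qed.

Lemma le_refl x : x <= x.
Proof. now right. Qed.

Lemma lt_succ_le x y : x < y <-> x + 1 <= y.
Proof.
  rewrite lt_exists, le_exists. split; intros [z ->]; exists z; ring.
Qed.

Lemma le_trans x y z : x <= y -> y <= z -> x <= z.
Proof.
  rewrite !le_exists. intros [a ->] [b ->]. exists (a + b). ring.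
Qed.

Lemma lt_le_trans x y z : x < y -> y <= z -> x < z.
Proof. rewrite !lt_succ_le. apply le_trans. Qed.

Lemma le_lt_trans x y z : x <= y -> y < z -> x < z.
Proof. rewrite <- lt_succ, (lt_succ_le y). apply lt_le_trans. Qed.

Lemma lt_trans x y z : x < y -> y < z -> x < z.
Proof. intros H1 H2. eapply lt_le_trans; [exact H1|now left]. Qed.

Lemma lt_not_le x y : x < y -> ~ y <= x.
Proof. intros H1 H2. apply (lt_irrefl x). eapply lt_le_trans; eassumption. Qed.

Lemma lt_neq x y : x < y -> x <> y.
Proof. intros H ->. now apply lt_irrefl in H. Qed.

Lemma lt_or_le x y : x < y \/ y <= x.
Proof.
  num_induction x.
  - destruct (le_0_l y) as [H|H]; [now left|right; now right].
  - destruct IH as [H|H]; [|right; eapply le_trans; [exact H|left; apply lt_succ, le_refl]].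
    apply lt_succ_le in H as [H| ->]; [now left|right; apply le_refl].
Qed.

Lemma trichotomy x y : x < y \/ x = y \/ y < x.
Proof. destruct (lt_or_le x y) as [H|[H|H]]; auto. Qed.

Lemma zero_or_succ x : x = 0 \/ exists y, x = y + 1.
Proof.
  destruct (le_0_l x) as [[y ->]%lt_exists|H]; [right|now left].
  exists y. ring.
Qed.

Lemma lt_0_succ x : 0 < x + 1.
Proof. apply lt_succ, le_0_l. Qed.

Lemma lt_succ_diag x : x < x + 1.
Proof. apply lt_succ, le_refl. Qed.

Lemma le_plus_r x y : x <= x + y.
Proof. apply le_exists. now exists y. Qed.

Lemma le_plus_l x y : y <= x + y.
Proof. apply le_exists. exists x. ring. Qed.

Lemma plus_le x x' y y' : x <= x' -> y <= y' -> x + y <= x' + y'.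
Proof.
  rewrite !le_exists. intros [a ->] [b ->]. exists (a + b). ring.
Qed.

Lemma plus_lt_le x x' y y' : x < x' -> y <= y' -> x + y < x' + y'.
Proof.
  rewrite lt_exists, le_exists, lt_exists. intros [a ->] [b ->]. exists (a + b). ring.
Qed.

Lemma plus_lt_l x y z : x < y <-> z + x < z + y.
Proof.
  rewrite !lt_exists. split; intros [a H]; exists a; [rewrite H; ring|].
  apply (plus_cancel_l _ _ z). rewrite H. ring.
Qed.

Lemma plus_lt_r x y z : x < y <-> x + z < y + z.
Proof. rewrite (plus_comm x), (plus_comm y). apply plus_lt_l. Qed.

Lemma mult_le x x' y y' : x <= x' -> y <= y' -> x * y <= x' * y'.
Proof.
  rewrite !le_exists. intros [a ->] [b ->]. exists (x * b + a * y + a * b). ring.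
Qed.

Lemma exp_pos x y : 0 < x -> 0 < x ^ y.
Proof.
  intros Hx. num_induction y; [rewrite exp_0_r, <- (plus_0_l 1); apply lt_0_succ|].
  rewrite exp_succ_r. apply lt_exists in Hx as [a ->]. apply lt_exists in IH as [b ->].
  apply lt_exists. exists (a * b + a + b). ring.
Qed.

Lemma exp_le_l x x' y : x <= x' -> x ^ y <= x' ^ y.
Proof.
  intros Hx. num_induction y; [rewrite !exp_0_r; apply le_refl|].
  rewrite !exp_succ_r. now apply mult_le.
Qed.

Lemma exp_plus x y z : x ^ (y + z) = x ^ y * x ^ z.
Proof.
  num_induction z; [rewrite exp_0_r, plus_0_r; ring|].
  rewrite plus_succ_r, !exp_succ_r, IH. ring.
Qed.

Lemma le_mult_pos x y : 0 < y -> x <= x * y.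
Proof. intros [z ->]%lt_exists. apply le_exists. exists (x * z). ring. Qed.

Lemma exp_le_r x y y' : 0 < x -> y <= y' -> x ^ y <= x ^ y'.
Proof.
  intros Hx [z ->]%le_exists. rewrite exp_plus. apply le_mult_pos. now apply exp_pos.
Qed.

(** The base is [x' + 1] because of [0 ^ 0 = 1]. *)
Lemma exp_le x x' y y' : x <= x' -> y <= y' -> x ^ y <= (x' + 1) ^ y'.
Proof.
  intros Hx Hy. eapply le_trans; [|apply exp_le_r; [apply lt_0_succ|exact Hy]].
  apply exp_le_l. eapply le_trans; [exact Hx|apply le_plus_r].
Qed.

Lemma division_unique (b q r q' r' : D) :
  r < b -> r' < b -> q * b + r = q' * b + r' -> q = q' /\ r = r'.
Proof.
  assert (Hlt : forall q q' r r' : D, r < b -> q < q' -> q * b + r = q' * b + r' -> False).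
  { intros p p' s s' Hs [z ->]%lt_exists H. apply (lt_not_le _ _ Hs).
    apply le_exists. exists (z * b + s'). apply (plus_cancel_l _ _ (p * b)). rewrite H. ring. }
  intros Hr Hr' H. destruct (trichotomy q q') as [Hq|[->|Hq]].
  - exfalso. eapply Hlt; [exact Hr| |]; eassumption.
  - split; [reflexivity|]. eapply plus_cancel_l, H.
  - exfalso. eapply Hlt; [exact Hr'| |symmetry]; eassumption.
Qed.

Lemma division (b x : D) : 0 < b -> exists q r, r < b /\ x = q * b + r.
Proof.
  intros Hb.
  (* A quotient never exceeds [x]; stating this makes the induction formula $\Sigma^0_0$. *)
  cut (exists q, q < x + 1 /\ exists r, r < b /\ x = q * b + r); [firstorder|].
  num_induction x.
  - exists 0. split; [apply lt_0_succ|]. exists 0. split; [exact Hb|ring].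
  - destruct IH as (q & Hq & r & Hr & Hx). apply lt_succ_le in Hr as [Hr|Hr].
    + exists q. split; [eapply lt_trans; [exact Hq|apply lt_succ_diag]|].
      exists (r + 1). split; [exact Hr|]. rewrite Hx. ring.
    + exists (q + 1). split; [now apply plus_lt_r|].
      exists 0. split; [exact Hb|]. rewrite Hx, <- Hr. ring.
Qed.

(** ** Definable functions *)

(** The term bound is what makes substitution possible: a predicate of the value of [f] becomes a
    bounded quantifier over that value, as in [definable_let], and stays $\Sigma^0_0$. *)
Definition definable_fun X (f : env -> D) : Prop :=
  (exists b, term_fun b /\ forall e, f e <= b e) /\
  definable X (fun e => e 0%nat = f (tl e)).

Lemma definable_let X f (Q : env -> D -> Prop) :
  definable_fun X f -> definable X (fun e => Q (tl e) (e 0%nat)) ->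
  definable X (fun e => Q e (f e)).
Proof.
  intros [(b & Hb & Hfb) Hf] HQ.
  apply definable_ext with (fun e => exists v, v < b e + 1 /\ (v = f e /\ Q e v)).
  - intros e. split; [intros (v & _ & -> & H); exact H|]. intros H.
    exists (f e). split; [apply lt_succ, Hfb|auto].
  - apply definable_ex_term; [term_definability; exact Hb|].
    now apply definable_and.
Qed.

Lemma term_definable_fun X f : term_fun f -> definable_fun X f.
Proof.
  intros Hf. split; [exists f; split; [exact Hf|intros; apply le_refl]|].
  term_definability. now apply term_rename.
Qed.

Lemma definable_fun_rename X f (r : nat -> nat) :
  definable_fun X f -> definable_fun X (fun e => f (fun n => e (r n))).
Proof.
  intros [(b & Hb & Hfb) Hf]. split.
  - exists (fun e => b (fun n => e (r n))). split; [now apply term_rename|intros; apply Hfb].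
  - apply (definable_rename X _ (fun n => match n with O => O | S n => S (r n) end)) in Hf.
    exact Hf.
Qed.

Lemma definable_eq X f g :
  definable_fun X f -> definable_fun X g -> definable X (fun e => f e = g e).
Proof.
  intros Hf Hg. apply (definable_let X f (fun e v => v = g e)); [exact Hf|apply Hg].
Qed.

Lemma definable_comp1 X f (P : D -> Prop) :
  definable X (fun e => P (e 0%nat)) -> definable_fun X f -> definable X (fun e => P (f e)).
Proof. intros HP Hf. now apply (definable_let X f (fun _ v => P v)). Qed.

Lemma definable_comp2 X f g (P : D -> D -> Prop) :
  definable X (fun e => P (e 0%nat) (e 1%nat)) -> definable_fun X f -> definable_fun X g ->
  definable X (fun e => P (f e) (g e)).
Proof.
  intros HP Hf Hg. apply (definable_let X f (fun e v => P v (g e))); [exact Hf|].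
  apply (definable_let X (fun e => g (tl e)) (fun e w => P (e 0%nat) w)).
  - apply (definable_fun_rename X g S Hg).
  - apply (definable_rename X _ (fun n => match n with O => 1 | 1 => 0 | n => n end)%nat HP).
Qed.

Lemma definable_comp3 X f g h (P : D -> D -> D -> Prop) :
  definable X (fun e => P (e 0%nat) (e 1%nat) (e 2%nat)) ->
  definable_fun X f -> definable_fun X g -> definable_fun X h ->
  definable X (fun e => P (f e) (g e) (h e)).
Proof.
  intros HP Hf Hg Hh. apply (definable_let X f (fun e v => P v (g e) (h e))); [exact Hf|].
  apply (definable_let X (fun e => g (tl e)) (fun e w => P (e 0%nat) w (h (tl e)))).
  - apply (definable_fun_rename X g S Hg).
  - apply (definable_let X (fun e => h (fun n => e (S (S n))))
      (fun e u => P (e 1%nat) (e 0%nat) u)).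
    + apply (definable_fun_rename X h (fun n => S (S n)) Hh).
    + apply (definable_rename X _
        (fun n => match n with O => 2 | 1 => 1 | 2 => 0 | n => n end)%nat HP).
Qed.

Lemma definable_lt X f g :
  definable_fun X f -> definable_fun X g -> definable X (fun e => f e < g e).
Proof. apply (definable_comp2 X f g lt). term_definability. Qed.

Lemma definable_mem X f : definable_fun X f -> definable X (fun e => mem (f e) X).
Proof. apply (definable_comp1 X f (fun v => mem v X)). apply definable_mem_var. Qed.

Lemma definable_ex X f (Q : env -> D -> Prop) :
  definable_fun X f -> definable X (fun e => Q (fun n => e (S n)) (e 0%nat)) ->
  definable X (fun e => exists x, x < f e /\ Q e x).
Proof.
  intros Hf HQ. apply (definable_let X f (fun e v => exists x, x < v /\ Q e x)); [exact Hf|].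
  apply definable_ex_term; [term_definability|].
  apply (definable_rename X _ (fun n => match n with O => O | S n => S (S n) end) HQ).
Qed.

Lemma definable_all X f (Q : env -> D -> Prop) :
  definable_fun X f -> definable X (fun e => Q (fun n => e (S n)) (e 0%nat)) ->
  definable X (fun e => forall x, x < f e -> Q e x).
Proof.
  intros Hf HQ. apply (definable_let X f (fun e v => forall x, x < v -> Q e x)); [exact Hf|].
  apply definable_all_term; [term_definability|].
  apply (definable_rename X _ (fun n => match n with O => O | S n => S (S n) end) HQ).
Qed.

(** The majorant [b] is separate from [op] because exponentiation is not monotone at base 0. *)
Lemma definable_fun_op2 X f g (op b : D -> D -> D) :
  (forall x x' y y', x <= x' -> y <= y' -> op x y <= b x' y') ->
  (forall f g, term_fun f -> term_fun g -> term_fun (fun e => b (f e) (g e))) ->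
  definable X (fun e => e 0%nat = op (e 1%nat) (e 2%nat)) ->
  definable_fun X f -> definable_fun X g -> definable_fun X (fun e => op (f e) (g e)).
Proof.
  intros Hle Hb Hop Hf Hg. split.
  - destruct Hf as [(bf & Hbf & Hf) _], Hg as [(bg & Hbg & Hg) _].
    exists (fun e => b (bf e) (bg e)). auto.
  - apply (definable_comp3 X (fun e => e 0%nat) (fun e => f (tl e)) (fun e => g (tl e))
      (fun v x y => v = op x y)); [exact Hop|apply term_definable_fun, term_var|..];
    now apply (definable_fun_rename X _ S).
Qed.

Lemma definable_plus X f g :
  definable_fun X f -> definable_fun X g -> definable_fun X (fun e => f e + g e).
Proof. apply definable_fun_op2 with plus; [apply plus_le|exact term_plus|term_definability]. Qed.

Lemma definable_mult X f g :
  definable_fun X f -> definable_fun X g -> definable_fun X (fun e => f e * g e).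
Proof. apply definable_fun_op2 with mult; [apply mult_le|exact term_mult|term_definability]. Qed.

Lemma definable_exp X f g :
  definable_fun X f -> definable_fun X g -> definable_fun X (fun e => f e ^ g e).
Proof.
  apply definable_fun_op2 with (fun x y => (x + 1) ^ y);
    [apply exp_le| |term_definability].
  intros. term_definability; assumption.
Qed.

Lemma definable_var X k : definable_fun X (fun e => e k).
Proof. apply term_definable_fun, term_var. Qed.

Lemma definable_const X p : definable_fun X (fun _ => p).
Proof. apply term_definable_fun, term_const. Qed.

Lemma definable_True X : definable X (fun _ => True).
Proof. apply definable_ext with (fun _ => False -> False); [tauto|apply definable_not, definable_False]. Qed.

Lemma definable_le X f g :
  definable_fun X f -> definable_fun X g -> definable X (fun e => f e <= g e).
Proof. intros Hf Hg. apply definable_or; [now apply definable_lt|now apply definable_eq]. Qed.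

(** * Definable lists of standard length *)

(** The length is a number of the metatheory and does not vary with the environment; only the
    entries do. *)
Definition definable_list X (l : env -> list D) : Prop :=
  exists fs, Forall (definable_fun X) fs /\ forall e, l e = map (fun f => f e) fs.

Lemma definable_nil X : definable_list X (fun _ => []).
Proof. exists []. auto. Qed.

Lemma definable_cons X f l :
  definable_fun X f -> definable_list X l -> definable_list X (fun e => f e :: l e).
Proof.
  intros Hf (fs & Hfs & Hl). exists (f :: fs). split; [now constructor|].
  intros e. simpl. now rewrite Hl.
Qed.

Lemma definable_app X l l' :
  definable_list X l -> definable_list X l' -> definable_list X (fun e => l e ++ l' e).
Proof.
  intros (fs & Hfs & Hl) (gs & Hgs & Hl'). exists (fs ++ gs). split; [now apply Forall_app|].
  intros e. now rewrite map_app, Hl, Hl'.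
Qed.

Lemma definable_const_list X l : definable_list X (fun _ => l).
Proof.
  induction l; [apply definable_nil|apply definable_cons; auto using definable_const].
Qed.

Lemma definable_map X {I} (f : env -> I -> D) (l : list I) :
  (forall i, definable_fun X (fun e => f e i)) -> definable_list X (fun e => map (f e) l).
Proof.
  intros Hf. exists (map (fun i e => f e i) l). split.
  - apply Forall_forall. intros g (i & <- & _)%in_map_iff. apply Hf.
  - intros e. now rewrite map_map.
Qed.

Lemma definable_list_rename X l (r : nat -> nat) :
  definable_list X l -> definable_list X (fun e => l (fun n => e (r n))).
Proof.
  intros (fs & Hfs & Hl). exists (map (fun f e => f (fun n => e (r n))) fs). split.
  - rewrite Forall_forall in *. intros g (f & <- & Hf)%in_map_iff.
    apply definable_fun_rename, Hfs, Hf.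
  - intros e. now rewrite Hl, map_map.
Qed.

Ltac definability_hook := fail.
Ltac definability1 :=
  lazymatch goal with
  | |- definable _ (fun e => _ -> False) => apply definable_not
  | |- definable _ (fun e => ~ _) => apply definable_not
  | |- definable _ (fun e => @?P e /\ @?Q e) => apply (definable_and _ P Q)
  | |- definable _ (fun e => @?P e \/ @?Q e) => apply (definable_or _ P Q)
  | |- definable _ (fun e => @?P e <-> @?Q e) => apply (definable_iff _ P Q)
  | |- definable _ (fun e => exists x, x < @?f e /\ @?Q e x) => apply (definable_ex _ f Q)
  | |- definable _ (fun e => forall x, x < @?f e -> @?Q e x) => apply (definable_all _ f Q)
  | |- definable _ (fun e => @?P e -> @?Q e) => apply (definable_imp _ P Q)
  | |- definable _ (fun e => @?f e < @?g e) => apply (definable_lt _ f g)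
  | |- definable _ (fun e => @?f e <= @?g e) => apply (definable_le _ f g)
  | |- definable _ (fun e => @eq (num _) (@?f e) (@?g e)) => apply (definable_eq _ f g)
  | |- definable _ (fun e => mem (@?f e) _) => apply (definable_mem _ f)
  | |- definable_fun _ (fun e => @?f e + @?g e) => apply (definable_plus _ f g)
  | |- definable_fun _ (fun e => @?f e * @?g e) => apply (definable_mult _ f g)
  | |- definable_fun _ (fun e => @?f e ^ @?g e) => apply (definable_exp _ f g)
  | |- definable_fun _ (fun e => e _) => apply definable_var
  | |- definable_fun _ (fun _ => _) => apply definable_const
  | |- definable_list _ (fun _ => ?l) => apply definable_const_list
  | |- definable_list _ (fun e => @?f e :: @?l e) => apply (definable_cons _ f l)
  | |- definable_list _ (fun e => @?l e ++ @?l' e) => apply (definable_app _ l l')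
  | |- definable_list _ (fun e => map (@?f e) ?l) => apply (definable_map _ f l); intros ?
  end.
Ltac definability_assumption :=
  match goal with
  | H : ?P |- ?P => exact H
  | H : definable_fun _ ?f |- definable_fun _ (fun e => ?f (fun n => e (@?r n))) =>
      exact (definable_fun_rename _ f r H)
  | H : definable_list _ ?f |- definable_list _ (fun e => ?f (fun n => e (@?r n))) =>
      exact (definable_list_rename _ f r H)
  | H : forall l v, definable_list _ l -> definable_fun _ v ->
          definable _ (fun e => ?F (l e) (v e))
    |- definable _ (fun e => ?F (@?l e) (@?v e)) => apply (H l v)
  end.
Ltac definability :=
  repeat (first [definability_assumption | definability1 | definability_hook]; cbv beta).

(** ** Pairs and tuples *)

Definition pair (x y : D) : D := (x + y) * (x + y) + x.

(** A pair with sum $s$ has its code between $s^2$ and $s^2+s$, hence below $(s+1)^2$; the code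
    determines the sum and then the first component. *)
Lemma pair_inj x y x' y' : pair x y = pair x' y' -> x = x' /\ y = y'.
Proof.
  assert (Hlt : forall x y x' y' : D, x + y < x' + y' -> pair x y < pair x' y').
  { intros a b a' b' Hs. unfold pair.
    apply lt_le_trans with ((a + b + 1) * (a + b + 1)).
    - apply lt_exists. exists (a + b + b). ring.
    - eapply le_trans; [|apply le_plus_r]. apply mult_le; now apply lt_succ_le. }
  intros H. destruct (trichotomy (x + y) (x' + y')) as [Hs|[Hs|Hs]].
  - apply Hlt, lt_neq in Hs. contradiction.
  - unfold pair in H. rewrite Hs in H. apply plus_cancel_l in H as ->.
    split; [reflexivity|]. eapply plus_cancel_l, Hs.
  - apply Hlt, lt_neq in Hs. congruence.
Qed.

Lemma pair_le x x' y y' : x <= x' -> y <= y' -> pair x y <= pair x' y'.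
Proof. intros. unfold pair. auto using plus_le, mult_le. Qed.

Lemma definable_pair X f g :
  definable_fun X f -> definable_fun X g -> definable_fun X (fun e => pair (f e) (g e)).
Proof. intros Hf Hg. unfold pair. definability. Qed.

Definition tuple_num (l : list D) : D :=
  match l with [] => 0 | x :: l => fold_left pair l x end.

Lemma tuple_num_snoc l x : l <> [] -> tuple_num (l ++ [x]) = pair (tuple_num l) x.
Proof. destruct l as [|y l]; [easy|]. simpl. now rewrite fold_left_app. Qed.

Lemma tuple_num_inj l l' : length l = length l' -> tuple_num l = tuple_num l' -> l = l'.
Proof.
  revert l'. induction l as [|x l IH] using rev_ind; intros l' Hlen H.
  - now destruct l'.
  - destruct l' as [|x' l' _] using rev_ind; rewrite !length_app in Hlen; simpl in Hlen;
      [lia|].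
    destruct l as [|y l], l' as [|y' l']; simpl in Hlen; try lia.
    + simpl in H. now subst.
    + rewrite !tuple_num_snoc in H by easy. apply pair_inj in H as [H ->].
      f_equal. apply IH; [simpl; lia|exact H].
Qed.

(** Supplies the number of digits that a code of a coloring must have. *)
Lemma tuple_num_bound r d : exists B, forall l,
  length l = d -> (forall x, In x l -> x <= r) -> tuple_num l < B.
Proof.
  cut (exists B, forall l, length l = d -> (forall x, In x l -> x <= r) -> tuple_num l <= B).
  { intros [B HB]. exists (B + 1). intros. apply lt_succ. auto. }
  destruct d as [|d].
  { exists 0. intros [|x l] Hl; [intros _; apply le_refl|discriminate]. }
  induction d as [|d [B HB]].
  - exists r. intros [|x [|y l]] Hl H; try discriminate. apply H. now left.
  - exists (pair B r). intros l Hl H.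
    destruct l as [|x l _] using rev_ind; [discriminate|].
    rewrite length_app in Hl. simpl in Hl.
    rewrite tuple_num_snoc by (intros ->; simpl in Hl; lia).
    apply pair_le; [apply HB; [lia|]|]; intros; apply H; apply in_or_app; simpl; auto.
Qed.

Lemma definable_tuple X l : definable_list X l -> definable_fun X (fun e => tuple_num (l e)).
Proof.
  intros (fs & Hfs & Hl).
  replace (fun e => tuple_num (l e)) with (fun e => tuple_num (map (fun f => f e) fs))
    by (extensionality e; now rewrite Hl).
  clear l Hl. induction fs as [|f fs IH] using rev_ind; [exact (definable_const X 0)|].
  apply Forall_app in Hfs as [Hfs Hf]. apply Forall_inv in Hf.
  destruct fs as [|g fs]; [exact Hf|].
  replace (fun e => tuple_num (map (fun f => f e) ((g :: fs) ++ [f])))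
    with (fun e => pair (tuple_num (map (fun f => f e) (g :: fs))) (f e)).
  - apply definable_pair; auto.
  - extensionality e. rewrite map_app. simpl map at 3. now rewrite tuple_num_snoc.
Qed.

Lemma definable_last X l : definable_list X l -> definable_fun X (fun e => last (l e) 0).
Proof.
  intros (fs & Hfs & Hl).
  replace (fun e => last (l e) 0) with (fun e => last (map (fun f => f e) fs) 0)
    by (extensionality e; now rewrite Hl).
  clear l Hl. induction fs as [|f fs IH]; [exact (definable_const X 0)|].
  inversion_clear Hfs. destruct fs as [|g fs]; simpl in *; auto.
Qed.

Lemma definable_eq_list X l l' :
  definable_list X l -> definable_list X l' -> definable X (fun e => l e = l' e).
Proof.
  intros (fs & Hfs & Hl) (gs & Hgs & Hl').
  apply definable_ext with (fun e => map (fun f => f e) fs = map (fun f => f e) gs).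
  { intros e. now rewrite Hl, Hl'. }
  clear l l' Hl Hl'. revert gs Hgs. induction Hfs as [|f fs Hf Hfs IH]; intros gs Hgs;
    destruct Hgs as [|g gs Hg Hgs]; simpl.
  - apply definable_ext with (fun _ => True); [now intros|apply definable_True].
  - apply definable_ext with (fun _ => False); [now intros|apply definable_False].
  - apply definable_ext with (fun _ => False); [now intros|apply definable_False].
  - apply definable_ext with (fun e => f e = g e /\ map (fun f => f e) fs = map (fun f => f e) gs).
    + intros e. split; [intros [-> ->]; reflexivity|intros H; now injection H].
    + apply definable_and; [now apply definable_eq|auto].
Qed.

(** * Increasing lists and quantifiers over lists *)

Fixpoint chain_num x (l : list D) (r : D) : Prop :=
  match l with [] => x <= r | y :: l => x < y /\ chain_num y l r end.
Definition increasing_num (l : list D) (r : D) : Prop :=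
  match l with [] => True | x :: l => chain_num x l r end.

Lemma definable_increasing X l f :
  definable_list X l -> definable_fun X f -> definable X (fun e => increasing_num (l e) (f e)).
Proof.
  intros (fs & Hfs & Hl) Hf.
  apply definable_ext with (fun e => increasing_num (map (fun f => f e) fs) (f e)).
  { intros e. now rewrite Hl. }
  clear l Hl. destruct Hfs as [|g fs Hg Hfs]; simpl.
  { apply definable_ext with (fun _ => True); [now intros|apply definable_True]. }
  revert g Hg. induction Hfs as [|g' fs Hg' Hfs IH]; intros g Hg; simpl; [definability|].
  apply definable_and; [definability|auto].
Qed.

Lemma increasing_tail x l r : increasing_num (x :: l) r -> increasing_num l r.
Proof. destruct l; simpl; tauto. Qed.

Lemma chain_num_app x l z r :
  chain_num x (l ++ [z]) r <-> chain_num x l r /\ last (x :: l) 0 < z /\ z <= r.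
Proof.
  revert x; induction l as [|y l IH]; intros x; simpl.
  - split; [|tauto]. intros [H1 H2]. split; [|tauto]. eapply le_trans; [left|]; eassumption.
  - rewrite IH. simpl. tauto.
Qed.

Lemma increasing_snoc l z r :
  l <> [] -> increasing_num (l ++ [z]) r <-> increasing_num l r /\ last l 0 < z /\ z <= r.
Proof. destruct l as [|x l]; [easy|]. intros _. apply chain_num_app. Qed.

Lemma increasing_le l r x : increasing_num l r -> In x l -> x <= r.
Proof.
  assert (Hx : forall y l, chain_num y l r -> y <= r).
  { intros y k; revert y; induction k as [|z k IH]; intros y; simpl; [auto|].
    intros [H1 H2%IH]. eapply le_trans; [left; exact H1|exact H2]. }
  induction l as [|y l IH]; intros H; [intros []|].
  intros [<-|Hin]; [eapply Hx, H|]. apply IH; [eapply increasing_tail, H|exact Hin].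
Qed.

(** The quantifier unfolds into [n] bounded number quantifiers. The renaming [r] in the hypothesis
    accounts for the coordinates that these quantifiers push back. *)
Lemma definable_all_list X n f (Q : env -> list D -> Prop) :
  definable_fun X f ->
  (forall r l, definable_list X l -> definable X (fun e => Q (fun k => e (r k)) (l e))) ->
  definable X (fun e => forall l, length l = n -> (forall x, In x l -> x < f e) -> Q e l).
Proof.
  revert f Q; induction n as [|n IH]; intros f Q Hf HQ.
  - apply definable_ext with (fun e => Q e []).
    + intros e. split; [|intros H; apply H; [reflexivity|intros x []]].
      intros H [|x l] Hl _; [exact H|discriminate].
    + apply (HQ (fun n => n) (fun _ => [])). apply definable_nil.
  - apply definable_ext with (fun e => forall x, x < f e ->
      forall l, length l = n -> (forall x, In x l -> x < f e) -> Q e (x :: l)).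
    + intros e. split.
      * intros H [|x l] Hl Hin; [discriminate|].
        apply H; [apply Hin; now left|now injection Hl|]. intros; apply Hin; now right.
      * intros H x Hx l Hl Hin. apply H; [simpl; congruence|]. intros y [<-|Hy]; auto.
    + apply definable_all; [exact Hf|].
      apply (IH (fun e => f (fun n => e (S n))) (fun e l => Q (fun n => e (S n)) (e 0%nat :: l)));
        [definability|].
      intros r l Hl. apply (HQ (fun k => r (S k)) (fun e => e (r 0%nat) :: l e)). definability.
Qed.

Lemma definable_ex_list X n f (Q : env -> list D -> Prop) :
  definable_fun X f ->
  (forall r l, definable_list X l -> definable X (fun e => Q (fun k => e (r k)) (l e))) ->
  definable X (fun e => exists l, length l = n /\ (forall x, In x l -> x < f e) /\ Q e l).
Proof.
  intros Hf HQ. apply definable_ext with (fun e => ~ forall l,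
    length l = n -> (forall x, In x l -> x < f e) -> ~ Q e l).
  - intros e. split.
    + intros H. apply NNPP. intros H'. apply H. intros l Hl Hin Hq. apply H'. eauto.
    + intros (l & Hl & Hin & Hq) H. exact (H l Hl Hin Hq).
  - apply definable_not. apply (definable_all_list X n f (fun e l => ~ Q e l)); [exact Hf|].
    intros r l Hl. apply definable_not. now apply HQ.
Qed.

(** ** Digits *)

(** Here [s] is the digit of [y] at $b^i$, with [q] made of the digits above and [r] of those below.
    The bound on [q] keeps the definition $\Sigma^0_0$. *)
Definition digit_of (b y i s : D) : Prop :=
  s < b /\ exists q, q < y + 1 /\ exists r, r < b ^ i /\ y = (q * b + s) * b ^ i + r.

(** The junk value for [b = 0] is [0]. *)
Definition digit (b y i : D) : D :=
  epsilon (inhabits 0) (fun s => (0 < b /\ digit_of b y i s) \/ (b = 0 /\ s = 0)).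

Lemma digit_of_exists b y i : 0 < b -> exists s, digit_of b y i s.
Proof.
  intros Hb. destruct (division (b ^ i) y) as (p & r & Hr & Hy); [now apply exp_pos|].
  destruct (division b p Hb) as (q & s & Hs & ->).
  exists s. split; [exact Hs|]. exists q. split; [|exists r; auto].
  apply lt_succ. apply le_trans with (q * b + s).
  - eapply le_trans; [apply (le_mult_pos _ b), Hb|apply le_plus_r].
  - rewrite Hy. eapply le_trans; [apply (le_mult_pos _ (b ^ i)), exp_pos, Hb|apply le_plus_r].
Qed.

Lemma digit_of_unique b y i s s' : digit_of b y i s -> digit_of b y i s' -> s = s'.
Proof.
  intros (Hs & q & _ & r & Hr & Hy) (Hs' & q' & _ & r' & Hr' & Hy').
  rewrite Hy' in Hy. apply division_unique in Hy as [Hy _]; [|assumption..].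
  apply division_unique in Hy as [_ Hy]; [|assumption..]. now symmetry.
Qed.

Lemma digit_iff b y i s :
  s = digit b y i <-> (0 < b /\ digit_of b y i s) \/ (b = 0 /\ s = 0).
Proof.
  assert (H : (0 < b /\ digit_of b y i (digit b y i)) \/ (b = 0 /\ digit b y i = 0)).
  { unfold digit. apply epsilon_spec. destruct (le_0_l b) as [Hb|<-]; [|exists 0; auto].
    destruct (digit_of_exists b y i Hb) as [s' Hs']. exists s'. auto. }
  split; [now intros ->|]. intros [[Hb Hs]|[-> ->]].
  - destruct H as [[_ H]|[-> _]]; [|now apply lt_irrefl in Hb].
    eapply digit_of_unique; eassumption.
  - destruct H as [[H _]|[_ H]]; [now apply lt_irrefl in H|now symmetry].
Qed.

Lemma digit_lt b y i : 0 < b -> digit b y i < b.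
Proof.
  intros Hb. destruct (proj1 (digit_iff b y i _) eq_refl) as [[_ [H _]]|[-> _]]; [exact H|].
  now apply lt_irrefl in Hb.
Qed.

Lemma digit_eq b y i q s r :
  s < b -> r < b ^ i -> y = (q * b + s) * b ^ i + r -> digit b y i = s.
Proof.
  intros Hs Hr Hy. assert (Hb : 0 < b) by (eapply le_lt_trans; [apply le_0_l|exact Hs]).
  destruct (proj1 (digit_iff b y i _) eq_refl)
    as [[_ (Hs' & q' & _ & r' & Hr' & Hy')]|[-> _]]; [|now apply lt_irrefl in Hb].
  rewrite Hy' in Hy. apply division_unique in Hy as [Hy _]; [|assumption..].
  now apply division_unique in Hy as [_ Hy]; [|assumption..].
Qed.

Lemma digit_le b y i : digit b y i <= y.
Proof.
  destruct (proj1 (digit_iff b y i _) eq_refl)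
    as [[Hb (Hs & q & _ & r & Hr & Hy)]|[_ ->]]; [|apply le_0_l].
  rewrite Hy at 2. eapply le_trans; [|apply le_plus_r].
  eapply le_trans; [|apply le_mult_pos, exp_pos, Hb]. apply le_plus_l.
Qed.

Lemma definable_digit X f g h :
  definable_fun X f -> definable_fun X g -> definable_fun X h ->
  definable_fun X (fun e => digit (f e) (g e) (h e)).
Proof.
  intros Hf Hg Hh. split.
  - destruct Hg as [(b & Hb & Hg) _]. exists b. split; [exact Hb|].
    intros e. eapply le_trans; [apply digit_le|apply Hg].
  - apply definable_ext with (fun e => (0 < f (tl e) /\ digit_of (f (tl e)) (g (tl e)) (h (tl e)) (e 0%nat))
      \/ (f (tl e) = 0 /\ e 0%nat = 0)).
    { intros e. symmetry. apply digit_iff. }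
    unfold digit_of, tl. definability.
Qed.

Ltac digit_hook :=
  lazymatch goal with
  | |- definable_fun _ (fun e => digit (@?f e) (@?g e) (@?h e)) =>
      apply (definable_digit _ f g h)
  | |- definable_fun _ (fun e => tuple_num (@?l e)) => apply (definable_tuple _ l)
  | |- definable_fun _ (fun e => last (@?l e) _) => apply (definable_last _ l)
  | |- definable_fun _ (fun e => pair (@?f e) (@?g e)) => apply (definable_pair _ f g)
  | |- definable _ (fun e => increasing_num (@?l e) (@?f e)) =>
      apply (definable_increasing _ l f)
  | |- definable _ (fun e => @eq (list _) (@?l e) (@?l' e)) => apply (definable_eq_list _ l l')
  end.
Ltac definability_hook ::= digit_hook.

Lemma append_lt b y k s : s < b -> y < b ^ k -> s * b ^ k + y < b ^ (k + 1).
Proof.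
  intros Hs Hy. rewrite exp_succ_r. apply lt_le_trans with (s * b ^ k + b ^ k).
  - now apply plus_lt_l.
  - replace (s * b ^ k + b ^ k) with ((s + 1) * b ^ k) by ring.
    apply mult_le; [now apply lt_succ_le|apply le_refl].
Qed.

Lemma digit_append_lt b y k s i : 0 < b -> i < k -> digit b (s * b ^ k + y) i = digit b y i.
Proof.
  intros Hb Hi.
  destruct (proj1 (digit_iff b y i _) eq_refl) as [[_ (Hs & q & _ & r & Hr & Hy)]|[-> _]];
    [|now apply lt_irrefl in Hb].
  apply lt_exists in Hi as [j ->].
  apply digit_eq with (q := s * b ^ j + q) (r := r); [exact Hs|exact Hr|].
  rewrite Hy at 1. replace (i + j + 1) with (j + 1 + i) by ring.
  rewrite exp_plus, exp_succ_r. ring.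
Qed.

Lemma digit_append_eq b y k s : s < b -> y < b ^ k -> digit b (s * b ^ k + y) k = s.
Proof. intros Hs Hy. apply digit_eq with (q := 0) (r := y); [assumption..|ring]. Qed.

(** The substitute for $\Sigma^0_1$ induction: codes of sequences of length [k] lie below [b ^ k],
    so the existence of a code for an initial segment is $\Sigma^0_0$, and induction on the length
    puts one more digit on top. *)
Lemma digit_comprehension X (b n : D) (P : D -> D -> Prop) :
  0 < b -> definable X (fun e => P (e 0%nat) (e 1%nat)) ->
  (forall i, i < n -> exists s, s < b /\ P i s) ->
  exists y, y < b ^ n /\ forall i, i < n -> P i (digit b y i).
Proof.
  intros Hb HP H.
  cut (forall k, k <= n -> exists y, y < b ^ k /\ forall i, i < k -> P i (digit b y i)).
  { intros H'. apply H', le_refl. }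
  intros k. pattern k. apply (induction X); clear k.
  - definability. apply (definable_comp2 X (fun e => e 0%nat)); [exact HP|definability..].
  - intros _. exists 0. split; [apply exp_pos, Hb|]. intros i []%nlt_0.
  - intros k IH Hk. apply lt_succ_le in Hk.
    destruct IH as (y & Hy & HyP); [now left|]. destruct (H k Hk) as (s & Hs & HsP).
    exists (s * b ^ k + y). split; [now apply append_lt|].
    intros i [Hi| ->]%lt_succ.
    + rewrite digit_append_lt by assumption. auto.
    + now rewrite digit_append_eq.
Qed.

(** * Least numbers, maxima and the pigeonhole principle *)

Lemma least_number X (P : D -> Prop) x :
  definable X (fun e => P (e 0%nat)) -> P x ->
  exists y, y <= x /\ P y /\ forall z, z < y -> ~ P z.
Proof.
  intros HP Hx. apply NNPP. intros HN.
  assert (H : forall z, z < x + 1 -> ~ P z); [|apply (H x); [apply lt_succ_diag|exact Hx]].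
  cut (forall n, n <= x + 1 -> forall z, z < n -> ~ P z); [intros H; apply H, le_refl|].
  intros n. pattern n. apply (induction X); clear n.
  - definability.
  - intros _ z []%nlt_0.
  - intros n IH Hn z [Hz| ->]%lt_succ.
    + apply IH; [|exact Hz]. eapply le_trans; [|exact Hn]. apply le_plus_r.
    + intros Hz. apply HN. exists n. apply lt_succ_le, lt_succ in Hn. split; [exact Hn|].
      split; [exact Hz|]. apply IH. eapply le_trans; [exact Hn|apply le_plus_r].
Qed.

(** The least strict upper bound is a successor because of [P 0], and by minimality its predecessor
    satisfies [P]. Searching below [B + 1] keeps the predicate $\Sigma^0_0$. *)
Lemma bounded_max X (P : D -> Prop) B :
  definable X (fun e => P (e 0%nat)) -> P 0 -> (forall x, P x -> x < B) ->
  exists x, P x /\ forall y, x < y -> ~ P y.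
Proof.
  intros HP H0 HB.
  destruct (least_number X (fun n => forall x, x < B + 1 -> P x -> x < n) B) as (n & _ & Hn & Hmin).
  - definability.
  - intros x _. apply HB.
  - assert (HB' : forall x, P x -> x < B + 1)
      by (intros x Hx; eapply lt_trans; [apply HB, Hx|apply lt_succ_diag]).
    destruct (zero_or_succ n) as [-> |[m ->]].
    { exfalso. apply (nlt_0 0), Hn; auto. }
    exists m. split.
    + apply NNPP. intros Hm. apply (Hmin m (lt_succ_diag m)).
      intros x Hx HPx. specialize (Hn x Hx HPx). apply lt_succ in Hn as [Hn| ->]; tauto.
    + intros y Hy HPy. apply (lt_not_le _ _ Hy). apply lt_succ. auto.
Qed.

(** Induction on [n]: if the digits were distinct, replacing the value [n] by the digit at the last
    place would give an injective sequence with one place and one value fewer. The code is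
    quantified inside the induction formula, and the fixed bound [b ^ N] keeps that formula
    $\Sigma^0_0$. *)
Lemma pigeonhole (b N n y : D) :
  0 < b -> n < N -> y < b ^ N -> (forall i, i < n + 1 -> digit b y i < n) ->
  exists i j, i < j /\ j < n + 1 /\ digit b y i = digit b y j.
Proof.
  intros Hb. revert y.
  cut (n < N -> forall y, y < b ^ N -> (forall i, i < n + 1 -> digit b y i < n) ->
    exists j, j < n + 1 /\ exists i, i < j /\ digit b y i = digit b y j).
  { intros H y Hn Hy Hd. destruct (H Hn y Hy Hd) as (j & Hj & i & Hi & E). eauto. }
  pattern n. apply (induction X0); clear n.
  - definability.
  - intros _ y _ H. exfalso. apply (nlt_0 (digit b y 0)), H, lt_0_succ.
  - intros n IH HN y Hy Hd. apply NNPP. intros Hinj.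
    assert (inj : forall i j, i < j -> j < n + 1 + 1 -> digit b y i <> digit b y j)
      by (intros i j Hi Hj E; apply Hinj; eauto).
    destruct (digit_comprehension X0 b N (fun i s =>
      (digit b y i = n /\ s = digit b y (n + 1)) \/ (~ digit b y i = n /\ s = digit b y i)) Hb)
      as (y' & Hy' & Hyd).
    + definability.
    + intros i _. destruct (classic (digit b y i = n)).
      * exists (digit b y (n + 1)). split; [now apply digit_lt|auto].
      * exists (digit b y i). split; [now apply digit_lt|auto].
    + assert (HnN : n < N) by (eapply lt_trans; [apply lt_succ_diag|exact HN]).
      assert (HiN : forall i, i < n + 1 -> i < N)
        by (intros i Hi; eapply lt_trans; eassumption).
      assert (Hi2 : forall i, i < n + 1 -> i < n + 1 + 1)
        by (intros i Hi; eapply lt_trans; [exact Hi|apply lt_succ_diag]).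
      destruct (IH HnN y' Hy') as (j & Hj & i & Hi & E).
      * intros i Hi. destruct (Hyd i (HiN i Hi)) as [[Hn ->]|[Hn ->]].
        -- destruct (proj1 (lt_succ _ _) (Hd (n + 1) (lt_succ_diag _))) as [H|H]; [exact H|].
           exfalso. apply (inj i (n + 1) Hi (lt_succ_diag _)). congruence.
        -- destruct (proj1 (lt_succ _ _) (Hd i (Hi2 i Hi))) as [H|H]; [exact H|contradiction].
      * assert (Hi' : i < n + 1) by (eapply lt_trans; eassumption).
        assert (Hij := inj i j Hi (Hi2 j Hj)).
        assert (Hin := inj i (n + 1) Hi' (lt_succ_diag _)).
        assert (Hjn := inj j (n + 1) Hj (lt_succ_diag _)).
        destruct (Hyd i (HiN i Hi')) as [[? ?]|[? ?]], (Hyd j (HiN j Hj)) as [[? ?]|[? ?]];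
          congruence.
Qed.

(** * Weakly homogeneous sequences *)

Fixpoint nat_num (n : nat) : D := match n with O => 0 | S n => nat_num n + 1 end.

Lemma nat_num_lt m n : (m < n)%nat -> nat_num m < nat_num n.
Proof.
  induction 1; simpl; [apply lt_succ_diag|]. eapply lt_trans; [eassumption|apply lt_succ_diag].
Qed.

(** [h] codes the sequence of its digits in base [b]. *)
Definition window (b h : D) (k : nat) (i : D) : list D :=
  map (fun j => digit b h (i + nat_num j)) (seq 0 k).

Lemma window_length b h k i : length (window b h k i) = k.
Proof. unfold window. now rewrite length_map, length_seq. Qed.

Lemma window_snoc b h k i : window b h (S k) i = window b h k i ++ [digit b h (i + nat_num k)].
Proof. unfold window. now rewrite seq_S, map_app. Qed.

Lemma window_cons b h k i : window b h (S k) i = digit b h i :: window b h k (i + 1).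
Proof.
  unfold window. simpl. rewrite plus_0_r. f_equal.
  rewrite <- seq_shift, map_map. apply map_ext. intros j. simpl. f_equal. ring.
Qed.

Lemma window_ext b h h' k i :
  (forall j, j < nat_num k -> digit b h (i + j) = digit b h' (i + j)) ->
  window b h k i = window b h' k i.
Proof.
  intros H. apply map_ext_in. intros j Hj%in_seq. apply H, nat_num_lt. lia.
Qed.

Lemma window_code b l : 0 < b -> (forall x, In x l -> x < b) ->
  exists h, h < b ^ nat_num (length l) /\ window b h (length l) 0 = l.
Proof.
  intros Hb. induction l as [|x l IH] using rev_ind; intros Hl.
  - exists 0. split; [now apply exp_pos|reflexivity].
  - destruct IH as (h & Hh & Hw); [intros; apply Hl, in_or_app; auto|].
    assert (Hx : x < b) by (apply Hl, in_or_app; simpl; auto).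
    exists (x * b ^ nat_num (length l) + h). rewrite length_app, Nat.add_comm. simpl.
    split; [now apply append_lt|]. rewrite window_snoc, plus_0_l, digit_append_eq by assumption.
    f_equal. rewrite <- Hw at 3. apply window_ext. intros j Hj. rewrite plus_0_l.
    now apply digit_append_lt.
Qed.

Definition increasing_seq (b h n : D) : Prop :=
  forall i, i < n -> i + 1 < n -> digit b h i < digit b h (i + 1).

Lemma window_increasing b h k r n i :
  increasing_seq b h n -> i + nat_num k <= n -> (forall j, digit b h j <= r) ->
  increasing_num (window b h k i) r.
Proof.
  intros Hinc Hi Hr. destruct k as [|k]; [exact I|]. rewrite window_cons.
  revert i Hi; induction k as [|k IH]; intros i Hi; [apply Hr|].
  rewrite window_cons. split.
  - assert (H : i + 1 < n).
    { eapply lt_le_trans; [|exact Hi]. apply plus_lt_l.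
      replace 1 with (nat_num 1) by apply plus_0_l. apply nat_num_lt. lia. }
    apply Hinc; [eapply lt_trans; [apply lt_succ_diag|exact H]|exact H].
  - apply IH. replace (i + 1 + nat_num (S k)) with (i + nat_num (S (S k))) by (simpl; ring).
    exact Hi.
Qed.

Lemma increasing_window_code l r b h :
  increasing_num l r -> window b h (length l) 0 = l -> increasing_seq b h (nat_num (length l)).
Proof.
  cut (forall a i, increasing_num l r -> window b h (length l) a = l ->
    i + 1 < nat_num (length l) -> digit b h (a + i) < digit b h (a + i + 1)).
  { intros H Hl Hw i _ Hi. rewrite <- (plus_0_l i). now apply H. }
  induction l as [|x l IH]; intros a i Hl Hw Hi.
  { now apply nlt_0 in Hi. }
  cbn [length] in Hw. rewrite window_cons in Hw. injection Hw as Hx Hw.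
  destruct (zero_or_succ i) as [-> |[i' ->]].
  - destruct l as [|y l].
    { now apply lt_irrefl in Hi. }
    cbn [length] in Hw. rewrite window_cons in Hw. injection Hw as Hy _.
    rewrite !plus_0_r, Hx, Hy. apply Hl.
  - replace (a + (i' + 1)) with (a + 1 + i') by ring.
    apply IH; [eapply increasing_tail, Hl|exact Hw|].
    cbn [length nat_num] in Hi. now apply plus_lt_r in Hi.
Qed.

Lemma definable_window X f g h k :
  definable_fun X f -> definable_fun X g -> definable_fun X h ->
  definable_list X (fun e => window (f e) (g e) k (h e)).
Proof. intros Hf Hg Hh. unfold window. definability. Qed.

Ltac window_hook :=
  lazymatch goal with
  | |- definable_list _ (fun e => window (@?f e) (@?g e) ?k (@?h e)) =>
      apply (definable_window _ f g h k)
  end.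
Ltac definability_hook ::= first [digit_hook | window_hook].

(** The base is [c + 1], as [c = 0] is allowed. *)
Definition color (c y : D) (l : list D) : D := digit (c + 1) y (tuple_num l).

(** The digits $h_0,\dots,h_m$ of [h] enumerate a weakly homogeneous set of size $m+1$;
    [i + nat_num d < m + 1] says that $h_{i+d}$ exists. *)
Definition homogeneous_seq (d : nat) (c y m r h : D) : Prop :=
  increasing_seq (r + 1) h (m + 1) /\
  forall i, i < m + 1 -> i + nat_num d < m + 1 ->
    color c y (window (r + 1) h d i) = color c y (window (r + 1) h d (i + 1)).

(** Some increasing sequence ends in the [k]-tuple [l] and its [s] windows of
    length [k + 1] all have color [j]. *)
Definition path (k : nat) (c y m r j s : D) (l : list D) : Prop :=
  s + nat_num k <= m + 1 /\
  exists h, h < (r + 1) ^ (m + 1) /\ increasing_seq (r + 1) h (s + nat_num k) /\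
    window (r + 1) h k s = l /\
    forall i, i < s -> color c y (window (r + 1) h (S k) i) = j.

Lemma definable_path X k (c y m r : D) f g l :
  definable_fun X f -> definable_fun X g -> definable_list X l ->
  definable X (fun e => path k c y m r (f e) (g e) (l e)).
Proof. intros Hf Hg Hl. unfold path, increasing_seq, color. definability. Qed.

Lemma path_0 c y m r j l :
  increasing_num l r -> nat_num (length l) <= m + 1 -> path (length l) c y m r j 0 l.
Proof.
  intros Hl Hm. split; [now rewrite plus_0_l|].
  destruct (window_code (r + 1) l) as (h & Hh & Hw); [apply lt_0_succ| |].
  { intros x Hx. apply lt_succ. eapply increasing_le; eassumption. }
  exists h. split; [|split; [|split; [exact Hw|intros i []%nlt_0]]].
  - eapply lt_le_trans; [exact Hh|]. apply exp_le_r; [apply lt_0_succ|exact Hm].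
  - rewrite plus_0_l. eapply increasing_window_code; eassumption.
Qed.

(** Appending [z] adds exactly the window [x :: l ++ [z]], whose color is the color of the path by
    choice. This is why the two overlapping tuples cannot have the same longest path in that
    color. *)
Lemma path_succ c y m r s x l z :
  increasing_num (x :: l ++ [z]) r -> s + nat_num (S (length l)) < m + 1 ->
  path (S (length l)) c y m r (color c y (x :: l ++ [z])) s (x :: l) ->
  path (S (length l)) c y m r (color c y (x :: l ++ [z])) (s + 1) (l ++ [z]).
Proof.
  set (k := length l). set (b := r + 1). set (n := s + nat_num (S k)).
  intros Hinc Hn (_ & h & Hh & Hhinc & Hw & Hcol). fold b n in Hh, Hhinc, Hw, Hcol.
  assert (Hb : 0 < b) by apply lt_0_succ.
  assert (Hz : last (x :: l) 0 < z /\ z <= r)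
    by (apply (increasing_snoc (x :: l)) in Hinc; [tauto|easy]).
  destruct Hz as [Hlast Hz%lt_succ]. fold b in Hz.
  assert (Hs : s + 1 + nat_num (S k) = n + 1) by (unfold n; ring).
  (* Digits of [h] from place [n] on are discarded; only then is [z] the digit at [n] after the
     addition, and the new code lies below [b ^ (n + 1)]. *)
  destruct (division (b ^ n) h) as (q & h0 & Hh0 & Hq); [now apply exp_pos|].
  set (h' := z * b ^ n + h0).
  assert (Hlt : forall i, i < n -> digit b h' i = digit b h i).
  { intros i Hi. unfold h'. rewrite Hq, !digit_append_lt; auto. }
  assert (Hnth : digit b h' n = z) by now apply digit_append_eq.
  assert (Hsn : digit b h (s + nat_num k) = last (x :: l) 0).
  { rewrite <- Hw, window_snoc. now rewrite last_last. }
  assert (Hwin : window b h' (S (S k)) s = x :: l ++ [z]).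
  { rewrite window_snoc. fold n. rewrite Hnth. change (x :: l ++ [z]) with ((x :: l) ++ [z]).
    f_equal. rewrite <- Hw. apply window_ext. intros j Hj. apply Hlt. now apply plus_lt_l. }
  split; [rewrite Hs; now apply lt_succ_le|]. fold b. rewrite Hs.
  exists h'. split; [|split; [|split]].
  - eapply lt_le_trans; [now apply append_lt|]. apply exp_le_r; [exact Hb|].
    now apply lt_succ_le.
  - intros i _ Hi. apply plus_lt_r in Hi. rewrite Hlt by exact Hi.
    apply lt_succ_le in Hi as [Hi|Hi].
    + rewrite Hlt by exact Hi. apply Hhinc; [|exact Hi].
      eapply lt_trans; [apply lt_succ_diag|exact Hi].
    + rewrite Hi, Hnth. replace i with (s + nat_num k); [now rewrite Hsn|].
      apply (plus_cancel_r _ _ 1). rewrite Hi. unfold n. simpl. ring.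
  - rewrite window_cons in Hwin. now injection Hwin.
  - intros i [Hi| ->]%lt_succ; [|now rewrite Hwin].
    rewrite <- (Hcol i Hi). f_equal. apply window_ext. intros j Hj. apply Hlt.
    apply lt_succ in Hj. unfold n. now apply plus_lt_le.
Qed.

Lemma path_homogeneous k c y m r j s l :
  s + nat_num k = m + 1 -> path k c y m r j s l ->
  exists h, h < (r + 1) ^ (m + 1) /\ homogeneous_seq (S k) c y m r h.
Proof.
  intros Hs (_ & h & Hh & Hinc & _ & Hcol). exists h. split; [exact Hh|]. split.
  - now rewrite <- Hs.
  - intros i _ Hi. rewrite <- Hs in Hi.
    assert (H : i + 1 < s).
    { apply (plus_lt_r _ _ (nat_num k)).
      replace (i + 1 + nat_num k) with (i + nat_num (S k)) by (simpl; ring). exact Hi. }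
    rewrite !Hcol; auto. eapply lt_trans; [apply lt_succ_diag|exact H].
Qed.

(** * Proper labellings of the shift graph *)

(** [F] is a proper coloring of the shift graph on increasing [k]-tuples. *)
Definition proper_labelling (k : nat) (r L : D) (F : list D -> D -> Prop) : Prop :=
  (forall l v, definable_list X0 l -> definable_fun X0 v ->
    definable X0 (fun e => F (l e) (v e))) /\
  (forall l, length l = k -> increasing_num l r -> exists v, v < L /\ F l v) /\
  (forall x l z v, length (x :: l) = k -> increasing_num (x :: l ++ [z]) r ->
    F (x :: l) v -> F (l ++ [z]) v -> False).

(** The [j]-th digit of the label of [l] is the length of the longest path of color
    [j] ending in [l]. *)
Lemma proper_labelling_start k (c y m r : D) :
  (0 < k)%nat -> nat_num k <= m + 1 -> 0 < m ->
  (forall l, length l = S k -> increasing_num l r -> color c y l < c) ->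
  (forall h, h < (r + 1) ^ (m + 1) -> ~ homogeneous_seq (S k) c y m r h) ->
  proper_labelling k r (m ^ c) (fun l v => forall j, j < c ->
    path k c y m r j (digit m v j) l /\
    forall s, s < m + 1 + 1 -> digit m v j < s -> ~ path k c y m r j s l).
Proof.
  intros Hk Hkm Hm Hcol Hhom.
  assert (Hpath : forall j s l, path k c y m r j s l -> s + nat_num k < m + 1).
  { intros j s l Hp. destruct (proj1 Hp) as [H|H]; [exact H|].
    destruct (path_homogeneous _ _ _ _ _ _ _ _ H Hp) as (h & Hh & Hhh).
    now apply Hhom in Hhh. }
  (* A path filling all [m + 1] places would be homogeneous, and a window takes [k >= 1] places; so
     lengths are below [m], one base-[m] digit per color suffices, and there are [m ^ c] labels. *)
  assert (Hpath' : forall j s l, path k c y m r j s l -> s < m).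
  { intros j s l Hp%Hpath. destruct k as [|k]; [lia|]. apply (plus_lt_r _ _ 1).
    eapply le_lt_trans; [|exact Hp]. apply plus_le; [apply le_refl|apply le_plus_l]. }
  split; [|split].
  - intros l v Hl Hv.
    assert (H : forall f g l, definable_fun X0 f -> definable_fun X0 g -> definable_list X0 l ->
      definable X0 (fun e => path k c y m r (f e) (g e) (l e)))
      by (intros; now apply definable_path).
    definability; apply H; definability.
  - intros l Hlen Hl. apply (digit_comprehension X0 m c (fun j s =>
      path k c y m r j s l /\ forall t, t < m + 1 + 1 -> s < t -> ~ path k c y m r j t l)).
    + exact Hm.
    + definability; apply definable_path; definability.
    + intros j Hj. destruct (bounded_max X0 (fun s => path k c y m r j s l) m) as (s & Hs & Hmax).
      * apply (definable_path X0 k c y m r (fun _ => j) (fun e => e 0%nat) (fun _ => l)); definability.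
      * rewrite <- Hlen. apply path_0; [exact Hl|now rewrite Hlen].
      * intros s. apply Hpath'.
      * exists s. split; [eapply Hpath', Hs|]. auto.
  - intros x l z v Hlen Hl H1 H2. cbn [length] in Hlen.
    set (j := color c y (x :: l ++ [z])).
    assert (Hj : j < c).
    { apply Hcol; [|exact Hl]. cbn [length]. rewrite length_app. simpl. lia. }
    destruct (H1 j Hj) as [Hp _]. destruct (H2 j Hj) as [_ Hmax].
    (* The longest path of color [j] at [x :: l], prolonged by [z], exceeds the maximum that the
       same label [v] records for [l ++ [z]]. *)
    apply (Hmax (digit m v j + 1)).
    + apply plus_lt_r. eapply lt_trans; [eapply Hpath', Hp|apply lt_succ_diag].
    + apply lt_succ_diag.
    + rewrite <- Hlen. apply path_succ; [exact Hl| |]; rewrite Hlen; [eapply Hpath, Hp|exact Hp].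
Qed.

(** The label of [l] is the binary code of the set of labels of extensions of [l]. *)
Lemma proper_labelling_step k r L F :
  (0 < k)%nat -> proper_labelling (S k) r L F ->
  proper_labelling k r ((1 + 1) ^ L) (fun l v => forall u, u < L ->
    (digit (1 + 1) v u = 1 <-> exists z, z < r + 1 /\ (last l 0 < z /\ F (l ++ [z]) u))).
Proof.
  intros Hk (HF & Htot & Hprop).
  assert (H1 : (1 : D) < 1 + 1) by apply lt_succ_diag.
  assert (H0 : (0 : D) < 1 + 1) by apply lt_0_succ.
  split; [|split].
  - intros l v Hl Hv. definability.
  - intros l Hlen Hl. apply (digit_comprehension X0 (1 + 1) L (fun u s =>
      (s = 1 <-> exists z, z < r + 1 /\ (last l 0 < z /\ F (l ++ [z]) u)))).
    + exact H0.
    + definability.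
    + intros u Hu.
      destruct (classic (exists z, z < r + 1 /\ (last l 0 < z /\ F (l ++ [z]) u))) as [H|H].
      * exists 1. tauto.
      * exists 0. split; [exact H0|]. split; [|tauto]. intros H01.
        exfalso. apply (succ_neq_0 0). now rewrite plus_0_l.
  - intros x l z v Hlen Hl Hv1 Hv2.
    (* The label [u] lies in the set belonging to [x :: l], with [z] as extension. If [l ++ [z]] had
       the same set, some extension of it by [z'] would carry [u] as well, and the two overlapping
       tuples would violate properness of [F]. *)
    destruct (Htot (x :: l ++ [z])) as (u & Hu & HFu); [|exact Hl|].
    { simpl in *. rewrite length_app. simpl. lia. }
    destruct (proj1 (increasing_snoc (x :: l) z r (ltac:(easy))) Hl) as (Hl1 & Hlast & Hz).
    assert (Hd : digit (1 + 1) v u = 1).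
    { apply (Hv1 u Hu). exists z. split; [now apply lt_succ|]. split; [exact Hlast|exact HFu]. }
    apply (Hv2 u Hu) in Hd as (z' & Hz' & Hlast' & HFu').
    apply (Hprop x (l ++ [z]) z' u); [|  |exact HFu|exact HFu'].
    + simpl in *. rewrite length_app. simpl. lia.
    + apply (increasing_snoc (x :: l ++ [z])); [easy|]. split; [exact Hl|].
      split; [|now apply lt_succ].
      change (x :: l ++ [z]) with ((x :: l) ++ [z]). rewrite last_last.
      now rewrite last_last in Hlast'.
Qed.

(** For single points the overlap is empty, so properness compares any [x < z] and makes the labels
    pairwise distinct; [r + 1] points do not fit into [L] labels. *)
Lemma no_short_labelling r L F : L <= r -> ~ proper_labelling 1 r L F.
Proof.
  intros HL (HF & Htot & Hprop).
  (* One label is chosen for each point; as [L <= r], the labels are digits in base [r + 1]. *)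
  destruct (digit_comprehension X0 (r + 1) (r + 1) (fun x v => v < L /\ F [x] v))
    as (y & Hy & Hyd).
  - apply lt_0_succ.
  - definability.
  - intros x Hx%lt_succ. destruct (Htot [x] eq_refl Hx) as (v & Hv & HFv).
    exists v. split; [|auto]. eapply lt_trans; [exact Hv|]. now apply lt_succ.
  - destruct (pigeonhole (r + 1) (r + 1) r y) as (i & j & Hij & Hj & E).
    + apply lt_0_succ.
    + apply lt_succ_diag.
    + exact Hy.
    + intros i Hi. eapply lt_le_trans; [apply Hyd, Hi|exact HL].
    + destruct (Hyd j Hj) as [_ HFj]. destruct (Hyd i) as [_ HFi]; [eapply lt_trans; eassumption|].
      apply (Hprop i [] j (digit (r + 1) y j)); [reflexivity| | |exact HFj].
      * split; [exact Hij|now apply lt_succ].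
      * now rewrite <- E.
Qed.

Fixpoint tower_num (n : nat) x : D :=
  match n with O => x | S n => (1 + 1) ^ tower_num n x end.

(** The induction is on the standard number [k], outside the model; each step produces a new
    definable labelling. *)
Lemma no_labelling k r L F :
  tower_num k L <= r -> ~ proper_labelling (S k) r L F.
Proof.
  (* The power set step lengthens the tower at its top, [tower_num] unfolds at its bottom. *)
  assert (Hswap : forall k x, tower_num k ((1 + 1) ^ x) = tower_num (S k) x)
    by (intros n x; induction n; simpl in *; congruence).
  revert L F; induction k as [|k IH]; intros L F HL HF.
  - now apply no_short_labelling in HF.
  - apply proper_labelling_step in HF; [|lia]. apply IH in HF; [exact HF|]. now rewrite Hswap.
Qed.

(** Here $d=k+2$: the labelled tuples have length $k+1$, and $k=d-2$ power set steps lead to single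
    points, which is the height of the tower. *)
Lemma homogeneous_exists k c y m r :
  nat_num (S k) <= m + 1 -> 0 < m -> tower_num k (m ^ c) <= r ->
  (forall l, length l = S (S k) -> increasing_num l r -> color c y l < c) ->
  exists h, h < (r + 1) ^ (m + 1) /\ homogeneous_seq (S (S k)) c y m r h.
Proof.
  intros Hk Hm HL Hcol. apply NNPP. intros HN.
  eapply no_labelling; [exact HL|].
  apply (proper_labelling_start (S k) c y m r); [lia|exact Hk|exact Hm|exact Hcol|].
  intros h Hh Hhom. apply HN. eauto.
Qed.

(** * The meaning of the formulas *)

Definition is_fun (f : set M) (A B : D -> Prop) : Prop :=
  (forall x, mem x f -> exists a b, x = pair a b /\ A a /\ B b) /\
  (forall a b b', mem (pair a b) f /\ mem (pair a b') f -> b = b') /\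
  (forall a, A a -> exists b, mem (pair a b) f).

Lemma sat_is_function e E f A B :
  sat e E (is_function f A B) <->
  is_fun (E f) (fun x => sat (scons x e) E A) (fun x => sat (scons x e) E B).
Proof.
  assert (Helem : forall a b x t A, eval (scons b (scons a (scons x e))) t = a \/
    eval (scons b (scons a (scons x e))) t = b ->
    sat (scons b (scons a (scons x e))) E (elem_at 3 t A) <->
    sat (scons (eval (scons b (scons a (scons x e))) t) e) E A).
  { intros a b x t A' _. unfold elem_at. rewrite sat_subst.
    match goal with |- sat ?e1 _ _ <-> sat ?e2 _ _ => replace e1 with e2; [tauto|] end.
    extensionality n. now destruct n. }
  unfold is_function, is_fun. cbn [sat].
  setoid_rewrite Helem; [|simpl; auto..]. reflexivity.
Qed.

Lemma is_fun_ext f A B A' B' :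
  (forall x, A x <-> A' x) -> (forall x, B x <-> B' x) -> is_fun f A B <-> is_fun f A' B'.
Proof. intros HA HB. unfold is_fun. setoid_rewrite HA. setoid_rewrite HB. reflexivity. Qed.

Lemma prepend_app_snoc (l : list D) x e : prepend (l ++ [x]) e = prepend l (scons x e).
Proof. unfold prepend. now rewrite fold_right_app. Qed.

Lemma sat_alls e E n A :
  sat e E (alls n A) <-> forall l, length l = n -> sat (prepend l e) E A.
Proof.
  revert e; induction n as [|n IH]; intros e; cbn [alls sat].
  - split; [intros H [|x l]; [auto|discriminate]|]. intros H. now apply (H []).
  - setoid_rewrite IH. split.
    + intros H l Hl. destruct l as [|x l _] using rev_ind; [discriminate|].
      rewrite length_app in Hl. simpl in Hl. rewrite prepend_app_snoc. apply H. lia.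
    + intros H x l Hl. rewrite <- prepend_app_snoc. apply H. rewrite length_app. simpl. lia.
Qed.

Lemma sat_exs e E n A :
  sat e E (exs n A) <-> exists l, length l = n /\ sat (prepend l e) E A.
Proof.
  revert e; induction n as [|n IH]; intros e; cbn [exs sat].
  - split; [intros H; now exists []|]. intros ([|x l] & Hl & H); [exact H|discriminate].
  - setoid_rewrite IH. split.
    + intros (x & l & Hl & H). exists (l ++ [x]). rewrite prepend_app_snoc, length_app.
      split; [simpl; lia|exact H].
    + intros (l & Hl & H). destruct l as [|x l _] using rev_ind; [discriminate|].
      rewrite length_app in Hl. simpl in Hl. rewrite prepend_app_snoc in H.
      exists x, l. split; [lia|exact H].
Qed.

Lemma prepend_ge (l : list D) e k : prepend l e (length l + k) = e k.
Proof. induction l; simpl; auto. Qed.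

Lemma prepend_nth (l : list D) e k : (k < length l)%nat -> prepend l e k = nth k l 0.
Proof.
  revert k; induction l as [|x l IH]; intros k Hk; simpl in *; [lia|].
  destruct k as [|k]; [reflexivity|]. apply IH. lia.
Qed.

Lemma map_prepend_seq (l : list D) e a n :
  (a + n <= length l)%nat -> map (prepend l e) (seq a n) = firstn n (skipn a l).
Proof.
  revert l; induction a as [|a IH]; intros l Hl.
  - simpl. revert l Hl. induction n as [|n IH]; intros l Hl; [reflexivity|].
    destruct l as [|x l]; simpl in *; [lia|]. f_equal. rewrite <- seq_shift, map_map.
    rewrite <- IH by lia. reflexivity.
  - destruct l as [|x l]; [simpl in Hl; lia|]. simpl skipn.
    rewrite <- IH by (simpl in Hl; lia). rewrite <- seq_shift, map_map. reflexivity.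
Qed.

Lemma eval_tuple e ts : eval e (tuple ts) = tuple_num (map (eval e) ts).
Proof.
  destruct ts as [|t ts]; [reflexivity|]. simpl.
  revert t; induction ts as [|u ts IH]; intros t; [reflexivity|]. simpl. now rewrite IH.
Qed.

Lemma eval_vars e a n : map (eval e) (vars a n) = map e (seq a n).
Proof. unfold vars. now rewrite map_map. Qed.

Lemma sat_Le e E t u : sat e E (t ≼ u) <-> eval e t <= eval e u.
Proof. reflexivity. Qed.

Lemma sat_increasing e E ts R :
  sat e E (increasing ts R) <-> increasing_num (map (eval e) ts) (eval e R).
Proof.
  destruct ts as [|t ts]; simpl; [tauto|].
  revert t; induction ts as [|u ts IH]; intros t; simpl; [reflexivity|]. now rewrite IH.
Qed.

Lemma sat_Conj e E l : sat e E (Conj l) <-> forall A, In A l -> sat e E A.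
Proof.
  induction l as [|A l IH]; simpl; [tauto|]. rewrite IH. split.
  - intros [H1 H2] B [<-|HB]; auto.
  - intros H. split; auto.
Qed.

Lemma eval_numeral e n : eval e (numeral n) = nat_num n.
Proof. induction n; simpl; congruence. Qed.

Lemma eval_tower e n t : eval e (tower n t) = tower_num n (eval e t).
Proof. induction n; simpl; congruence. Qed.

(** * Ramsey statements read in the model *)

Definition is_tuple (d : nat) r x : Prop :=
  exists l, length l = d /\ x = tuple_num l /\ increasing_num l r.

Definition is_coloring (d : nat) (C : set M) r c : Prop :=
  is_fun C (is_tuple d r) (fun v => v < c).

Definition is_enumeration (h H : set M) n : Prop :=
  is_fun h (fun i => i < n) (fun x => mem x H) /\
  (forall i j x y, mem (pair i x) h /\ mem (pair j y) h /\ i < j -> x < y) /\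
  (forall x, mem x H -> exists i, mem (pair i x) h).

Definition is_weakly_homogeneous (d : nat) (C h : set M) : Prop :=
  forall i l, length l = S d ->
  (forall j, (j < S d)%nat -> mem (pair (i + nat_num j) (nth j l 0)) h) ->
  exists v, mem (pair (tuple_num (firstn d l)) v) C /\
            mem (pair (tuple_num (skipn 1 l)) v) C.

Definition is_ramsey (d : nat) c m r : Prop :=
  forall C, is_coloring d C r c ->
  exists H, (forall x, mem x H -> x <= r) /\
  exists h, is_enumeration h H (m + 1) /\ is_weakly_homogeneous d C h.

Lemma sat_tuples e E d R x :
  sat (scons x e) E (tuples d R) <-> is_tuple d (eval e R) x.
Proof.
  unfold tuples, is_tuple. rewrite sat_exs.
  assert (H : forall l, length l = d ->
    (sat (prepend l (scons x e)) E (Var d ≐ tuple (vars 0 d) ⩑ increasing (vars 0 d) (shift (S d) R))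
     <-> x = tuple_num l /\ increasing_num l (eval e R))).
  { intros l <-. cbn [sat eval]. rewrite sat_increasing, eval_tuple, eval_vars, eval_shift.
    rewrite map_prepend_seq by lia. rewrite firstn_all.
    replace (prepend l (scons x e) (length l)) with x
      by (rewrite <- (Nat.add_0_r (length l)) at 1; now rewrite prepend_ge).
    replace (fun n => prepend l (scons x e) (S (length l) + n)) with e; [reflexivity|].
    extensionality n. replace (S (length l) + n)%nat with (length l + S n)%nat by lia.
    now rewrite prepend_ge. }
  split; intros (l & Hl & Hs); exists l; (split; [exact Hl|]); now apply H.
Qed.

Lemma sat_coloring e E d C R c :
  sat e E (coloring d C R c) <-> is_coloring d (E C) (eval e R) (eval e c).
Proof.
  unfold coloring, is_coloring. rewrite sat_is_function. apply is_fun_ext; intros x.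
  - apply sat_tuples.
  - unfold below. cbn [sat]. rewrite eval_shift. reflexivity.
Qed.

Lemma sat_enumerates e E h H n :
  sat e E (enumerates h H n) <-> is_enumeration (E h) (E H) (eval e n).
Proof.
  unfold enumerates, is_enumeration. cbn [sat]. rewrite sat_is_function.
  rewrite (is_fun_ext (E h) _ _ (fun i => i < eval e n) (fun x => mem x (E H))).
  - reflexivity.
  - intros x. unfold below. cbn [sat]. rewrite eval_shift. reflexivity.
  - intros x. reflexivity.
Qed.

Lemma sat_consecutive_equal e E d C h :
  sat e E (consecutive_equal d C h) <-> is_weakly_homogeneous d (E C) (E h).
Proof.
  unfold consecutive_equal, is_weakly_homogeneous. cbn [sat].
  enough (H : forall i,
    sat (scons i e) E (alls (S d) (Conj (map (fun j =>
      opair (Plus (Var (S d)) (numeral j)) (Var j) ∈ h) (seq 0 (S d))) ⟶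
      ExNum (opair (tuple (vars 1 d)) (Var 0) ∈ C ⩑ opair (tuple (vars 2 d)) (Var 0) ∈ C)))
    <-> forall l, length l = S d ->
      (forall j, (j < S d)%nat -> mem (pair (i + nat_num j) (nth j l 0)) (E h)) ->
      exists v, mem (pair (tuple_num (firstn d l)) v) (E C) /\
                mem (pair (tuple_num (skipn 1 l)) v) (E C))
    by (split; intros H' i; apply H, H').
  intros i. rewrite sat_alls.
  (* Both tuples at once: [a = 0] gives $h_i,\dots,h_{i+d-1}$ and [a = 1] gives
     $h_{i+1},\dots,h_{i+d}$. The variables start at [S a] because index 0 is the common color
     [v]. *)
  assert (Heq : forall l, length l = S d -> forall v a, (a <= 1)%nat ->
    eval (scons v (prepend l (scons i e))) (tuple (vars (S a) d))
      = tuple_num (firstn d (skipn a l))).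
  { intros l Hl v a Ha. rewrite eval_tuple, eval_vars. rewrite <- seq_shift, map_map.
    cbn [scons]. rewrite <- map_prepend_seq with (e := scons i e) by lia. reflexivity. }
  assert (Hpre : forall l, length l = S d ->
    (sat (prepend l (scons i e)) E
      (Conj (map (fun j => opair (Plus (Var (S d)) (numeral j)) (Var j) ∈ h) (seq 0 (S d))))
     <-> forall j, (j < S d)%nat -> mem (pair (i + nat_num j) (nth j l 0)) (E h))).
  { intros l Hl. rewrite sat_Conj.
    assert (Hj : forall j, (j < S d)%nat ->
      eval (prepend l (scons i e)) (opair (Plus (Var (S d)) (numeral j)) (Var j))
      = pair (i + nat_num j) (nth j l 0)).
    { intros j Hj. change (pair (prepend l (scons i e) (S d) + eval (prepend l (scons i e)) (numeral j))
        (prepend l (scons i e) j) = pair (i + nat_num j) (nth j l 0)).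
      rewrite eval_numeral, (prepend_nth l (scons i e) j) by lia. rewrite <- Hl.
      rewrite <- (Nat.add_0_r (length l)) at 1. now rewrite prepend_ge. }
    split.
    - intros H j Hlt. rewrite <- Hj by exact Hlt.
      apply (H (opair (Plus (Var (S d)) (numeral j)) (Var j) ∈ h)).
      apply in_map_iff. exists j. split; [reflexivity|]. apply in_seq. lia.
    - intros H A (j & <- & Hin%in_seq)%in_map_iff. cbn [sat]. rewrite Hj by lia.
      apply H. lia. }
  assert (Hpost : forall l, length l = S d ->
    (sat (prepend l (scons i e)) E (ExNum (opair (tuple (vars 1 d)) (Var 0) ∈ C
            ⩑ opair (tuple (vars 2 d)) (Var 0) ∈ C))
     <-> exists v, mem (pair (tuple_num (firstn d l)) v) (E C) /\
            mem (pair (tuple_num (skipn 1 l)) v) (E C))).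
  { intros l Hl. cbn [sat].
    assert (Hp : forall v a, (a <= 1)%nat ->
      eval (scons v (prepend l (scons i e))) (opair (tuple (vars (S a) d)) (Var 0))
      = pair (tuple_num (firstn d (skipn a l))) v).
    { intros v a Ha. rewrite <- (Heq l Hl v a Ha). reflexivity. }
    assert (Hp1 := fun v => Hp v 1%nat (le_n 1)).
    rewrite firstn_all2 in Hp1 by (rewrite length_skipn; lia).
    split; intros (v & H1 & H2); exists v.
    - rewrite (Hp v 0%nat) in H1 by lia. rewrite Hp1 in H2. auto.
    - rewrite (Hp v 0%nat) by lia. rewrite Hp1. auto. }
  split; intros H l Hl Hj.
  - apply Hpost, H; [exact Hl..|]. now apply Hpre.
  - apply Hpost; [exact Hl|]. apply H; [exact Hl|]. now apply Hpre.
Qed.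

Lemma sat_weak_ramsey e E d c m R :
  sat e E (weak_ramsey d c m R) <-> is_ramsey d (eval e c) (eval e m) (eval e R).
Proof.
  unfold weak_ramsey, is_ramsey, weakly_homogeneous. cbn [sat].
  setoid_rewrite sat_coloring. setoid_rewrite sat_enumerates.
  setoid_rewrite sat_consecutive_equal. cbn [scons eval].
  setoid_rewrite sat_Le. setoid_rewrite eval_shift. reflexivity.
Qed.

(** * Coding colorings and homogeneous sets by numbers *)

(** With numbers in place of sets, and [B] fixed, all quantifiers are bounded, so the least number
    principle applies to [r]; [is_ramsey] quantifies over sets. *)
Definition is_coded_ramsey (d : nat) (c m B r : D) : Prop :=
  forall y, y < (c + 1) ^ B ->
  (forall l, length l = d -> (forall x, In x l -> x < r + 1) ->
    increasing_num l r -> color c y l < c) ->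
  exists h, h < (r + 1) ^ (m + 1) /\ homogeneous_seq d c y m r h.

Lemma increasing_seq_lt b h n i j :
  increasing_seq b h n -> i < j -> j < n -> digit b h i < digit b h j.
Proof.
  intros H. pattern j. apply (induction X0); clear j.
  - definability.
  - intros []%nlt_0.
  - intros j IH [Hi| ->]%lt_succ Hj; [|apply H; [|exact Hj]].
    + eapply lt_trans; [apply IH; [exact Hi|]|apply H; [|exact Hj]];
        (eapply lt_trans; [apply lt_succ_diag|exact Hj]).
    + eapply lt_trans; [apply lt_succ_diag|exact Hj].
Qed.

Lemma is_ramsey_of_coded d c m B r :
  (forall l, length l = d -> (forall x, In x l -> x <= r) -> tuple_num l < B) ->
  is_coded_ramsey d c m B r -> is_ramsey d c m r.
Proof.
  intros HB H C (HC1 & HC2 & HC3).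
  (* Indices that do not code a tuple in the domain have no color and get the default digit 0, which
     base [c + 1] allows even for [c = 0]. *)
  destruct (digit_comprehension C (c + 1) B (fun i s =>
    (s < c /\ mem (pair i s) C) \/ (s = 0 /\ forall t, t < c -> ~ mem (pair i t) C)))
    as (y & Hy & Hyd).
  - apply lt_0_succ.
  - definability.
  - intros i _. destruct (classic (exists s, s < c /\ mem (pair i s) C)) as [(s & Hs & Hm)|HN].
    + exists s. split; [eapply lt_trans; [exact Hs|apply lt_succ_diag]|auto].
    + exists 0. split; [apply lt_0_succ|]. right. split; [reflexivity|]. eauto.
  - assert (Hcol : forall l, length l = d -> increasing_num l r ->
      color c y l < c /\ mem (pair (tuple_num l) (color c y l)) C).
    { intros l Hl Hinc.
      destruct (Hyd (tuple_num l)) as [Hd|[_ HN]]; [|exact Hd|].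
      { apply HB; [exact Hl|]. intros x. now apply increasing_le. }
      exfalso. destruct (HC3 (tuple_num l)) as [v Hv]; [now exists l|].
      apply (HN v); [|exact Hv].
      destruct (HC1 _ Hv) as (a & b & [_ ->]%pair_inj & _ & Hb). exact Hb. }
    destruct (H y Hy) as (h & Hh & Hinc & Hhom).
    { intros l Hl _ Hli. now apply Hcol. }
    set (b := r + 1) in *.
    destruct (comprehension X0 (fun p => exists i, i < m + 1 /\ p = pair i (digit b h i)))
      as [hs Hhs]; [definability|].
    destruct (comprehension X0 (fun x => exists i, i < m + 1 /\ x = digit b h i))
      as [H' HH']; [definability|].
    assert (Hpair : forall i x, mem (pair i x) hs <-> i < m + 1 /\ x = digit b h i).
    { intros i x. rewrite Hhs. split.
      - now intros (j & Hj & [-> ->]%pair_inj).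
      - intros [Hi ->]. now exists i. }
    exists H'. split.
    { intros x (i & _ & ->)%HH'. apply lt_succ, digit_lt, lt_0_succ. }
    exists hs. split; [split; [split; [|split]|split]|].
    + intros p (i & Hi & ->)%Hhs. exists i, (digit b h i). split; [reflexivity|].
      split; [exact Hi|]. apply HH'. eauto.
    + intros i x x' [[_ ->]%Hpair [_ ->]%Hpair]. reflexivity.
    + intros i Hi. exists (digit b h i). now apply Hpair.
    + intros i j x x' ([_ ->]%Hpair & [Hj ->]%Hpair & Hij).
      eapply increasing_seq_lt; eassumption.
    + intros x (i & Hi & ->)%HH'. exists i. now apply Hpair.
    + intros i l Hl Hj.
      assert (Hid : i + nat_num d < m + 1) by (apply Hpair with (x := nth d l 0), Hj; lia).
      assert (Hi : i < m + 1) by (eapply le_lt_trans; [apply le_plus_r|exact Hid]).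
      assert (Hlw : l = window b h (S d) i).
      { apply nth_ext with 0 0; [now rewrite window_length|]. rewrite Hl. intros j Hjd.
        destruct (proj1 (Hpair _ _) (Hj j Hjd)) as [_ ->]. unfold window.
        rewrite nth_indep with (d' := digit b h (i + nat_num 0)) by
          now rewrite length_map, length_seq.
        rewrite map_nth with (f := fun j => digit b h (i + nat_num j)).
        now rewrite seq_nth. }
      assert (Hw : forall i, i + nat_num d <= m + 1 -> increasing_num (window b h d i) r).
      { intros i' Hi'. eapply window_increasing; [exact Hinc|exact Hi'|].
        intros j. apply lt_succ, digit_lt, lt_0_succ. }
      exists (color c y (window b h d i)). split.
      * rewrite Hlw, window_snoc, firstn_app, window_length, Nat.sub_diag, app_nil_r.
        rewrite firstn_all2 by now rewrite window_length.
        apply Hcol; [apply window_length|apply Hw; now left].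
      * rewrite Hhom by assumption. rewrite Hlw, window_cons. simpl skipn.
        apply Hcol; [apply window_length|apply Hw].
        replace (i + 1 + nat_num d) with (i + nat_num d + 1) by ring. now apply lt_succ_le.
Qed.

(** Holds for every [B]: digits are defined at all places, so any [y] whose relevant digits are
    below [c] yields a coloring as a set. *)
Lemma coded_of_is_ramsey d c m B r : is_ramsey d c m r -> is_coded_ramsey d c m B r.
Proof.
  intros H y _ Hcol.
  assert (Hcol' : forall l, length l = d -> increasing_num l r -> color c y l < c).
  { intros l Hl Hinc. apply Hcol; [exact Hl| |exact Hinc].
    intros x Hx. apply lt_succ. eapply increasing_le; eassumption. }
  destruct (comprehension X0 (fun p => exists l, length l = d /\
    (forall x, In x l -> x < r + 1) /\
    (p = pair (tuple_num l) (color c y l) /\ increasing_num l r))) as [C HC].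
  { apply (definable_ex_list X0 d (fun _ => r + 1) (fun e l =>
      e 0%nat = pair (tuple_num l) (color c y l) /\ increasing_num l r)); [definability|].
    intros r' l Hl. unfold color. definability. }
  assert (Hpair : forall l v, length l = d -> mem (pair (tuple_num l) v) C ->
    v = color c y l).
  { intros l v Hl (l' & Hl' & _ & [Ht ->]%pair_inj & _)%HC.
    apply tuple_num_inj in Ht; [now subst|congruence]. }
  destruct (H C) as (H' & HH' & h & ((Hh1 & Hh2 & Hh3) & Hinc & _) & Hhom).
  { split; [|split].
    - intros p (l & Hl & _ & -> & Hli)%HC. exists (tuple_num l), (color c y l).
      split; [reflexivity|]. split; [now exists l|auto].
    - intros a v v' [Hv Hv'].
      destruct (proj1 (HC _) Hv) as (l & Hl & _ & [-> _]%pair_inj & _).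
      rewrite (Hpair l v), (Hpair l v'); auto.
    - intros a (l & Hl & -> & Hli). exists (color c y l). apply HC. exists l.
      split; [exact Hl|]. split; [|auto].
      intros x Hx. apply lt_succ. eapply increasing_le; eassumption. }
  destruct (digit_comprehension h (r + 1) (m + 1) (fun i s => mem (pair i s) h))
    as (g & Hg & Hgd).
  - apply lt_0_succ.
  - definability.
  - intros i Hi. destruct (Hh3 i Hi) as [s Hs]. exists s. split; [|exact Hs].
    apply lt_succ, HH'. destruct (Hh1 _ Hs) as (a & b & [_ ->]%pair_inj & _ & Hb). exact Hb.
  - exists g. split; [exact Hg|]. split.
    + intros i Hi Hi'. apply (Hinc i (i + 1)). split; [auto|]. split; [auto|apply lt_succ_diag].
    + intros i _ Hi.
      destruct (Hhom i (window (r + 1) g (S d) i)) as (v & Hv1 & Hv2).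
      * apply window_length.
      * intros j Hj. unfold window.
        rewrite nth_indep with (d' := digit (r + 1) g (i + nat_num 0)) by
          now rewrite length_map, length_seq.
        rewrite map_nth with (f := fun j => digit (r + 1) g (i + nat_num j)).
        rewrite seq_nth by exact Hj. apply Hgd. eapply le_lt_trans; [|exact Hi].
        apply plus_le; [apply le_refl|]. destruct (Nat.eq_dec j d) as [->|Hne]; [apply le_refl|].
        left. apply nat_num_lt. simpl. lia.
      * rewrite window_snoc, firstn_app, window_length, Nat.sub_diag, app_nil_r in Hv1.
        rewrite firstn_all2 in Hv1 by now rewrite window_length.
        rewrite window_cons in Hv2. simpl skipn in Hv2.
        apply Hpair in Hv1; [|apply window_length]. apply Hpair in Hv2; [|apply window_length].
        congruence.
Qed.

(** The digit count [B] found for [r] is large enough for every [r'] up to [r], so one fixed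
    $\Sigma^0_0$ predicate decides all candidates. *)
Lemma least_ramsey d c m r :
  is_ramsey d c m r ->
  exists r', r' <= r /\ is_ramsey d c m r' /\ forall z, z < r' -> ~ is_ramsey d c m z.
Proof.
  intros Hr. destruct (tuple_num_bound r d) as [B HB].
  destruct (least_number X0 (is_coded_ramsey d c m B) r) as (r' & Hr' & H & Hmin).
  - unfold is_coded_ramsey. apply definable_all; [definability|].
    apply (definable_imp X0 (fun e => forall l, length l = d ->
      (forall x, In x l -> x < e 1%nat + 1) -> increasing_num l (e 1%nat) -> color c (e 0%nat) l < c)).
    + apply (definable_all_list X0 d (fun e => e 1%nat + 1) (fun e l =>
        increasing_num l (e 1%nat) -> color c (e 0%nat) l < c)); [definability|].
      intros r' l Hl. unfold color. definability.
    + unfold homogeneous_seq, increasing_seq, color. definability.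
  - now apply coded_of_is_ramsey.
  - exists r'. split; [exact Hr'|]. split.
    + eapply is_ramsey_of_coded; [|exact H]. intros l Hl Hx. apply HB; [exact Hl|].
      intros x Hin. eapply le_trans; [apply Hx, Hin|exact Hr'].
    + intros z Hz HN. apply (Hmin z Hz). now apply coded_of_is_ramsey.
Qed.

(** * The bound *)

Lemma succ_le_exp2 x : x + 1 <= (1 + 1) ^ x.
Proof.
  num_induction x; [rewrite exp_0_r, plus_0_l; apply le_refl|].
  rewrite exp_succ_r. replace ((1 + 1) * (1 + 1) ^ x) with ((1 + 1) ^ x + (1 + 1) ^ x) by ring.
  apply plus_le; [exact IH|]. eapply le_trans; [|exact IH]. apply le_plus_l.
Qed.

Lemma tower_num_le k x y : x <= y -> tower_num k x <= tower_num k y.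
Proof.
  intros H. induction k; simpl; [exact H|]. apply exp_le_r; [apply lt_0_succ|assumption].
Qed.

Lemma le_tower_num k x : x <= tower_num k x.
Proof.
  induction k as [|k IH]; simpl; [apply le_refl|].
  eapply le_trans; [|apply succ_le_exp2]. eapply le_trans; [exact IH|apply le_plus_r].
Qed.

(** Serves the case [c = 0], where the bound degenerates to $T_k(m^0)=T_k(1)$ and $d-1=k+1$ must lie
    below it. *)
Lemma nat_num_le_tower_num k : nat_num (S k) <= tower_num k 1.
Proof.
  induction k as [|k IH]; [simpl; rewrite plus_0_l; apply le_refl|].
  cbn [tower_num]. eapply le_trans; [|apply succ_le_exp2].
  apply plus_le; [exact IH|apply le_refl].
Qed.

Lemma exists_increasing n : exists l, length l = n /\ forall r,
  nat_num n <= r + 1 -> increasing_num l r.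
Proof.
  exists (map nat_num (seq 0 n)). rewrite length_map, length_seq. split; [reflexivity|].
  intros r Hr. destruct n as [|n]; [exact I|]. simpl.
  assert (H : forall a, nat_num (a + n) <= r ->
    chain_num (nat_num a) (map nat_num (seq (S a) n)) r).
  { clear Hr. induction n as [|n IH]; intros a Ha; simpl.
    - now rewrite Nat.add_0_r in Ha.
    - split; [apply lt_succ_diag|]. apply (IH (S a)).
      now replace (S a + n)%nat with (a + S n)%nat by lia. }
  apply (H 0%nat). cbn in Hr. apply lt_succ. now apply lt_succ_le.
Qed.

(** The interval $[0,k]$ contains an increasing $(k+1)$-tuple, which cannot be given a color below
    0; so there is no coloring at all. *)
Lemma ramsey_no_colors k m : is_ramsey (S k) 0 m (nat_num k).
Proof.
  intros C (HC1 & _ & HC3).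
  destruct (exists_increasing (S k)) as (l & Hl & Hinc).
  destruct (HC3 (tuple_num l)) as [v Hv]; [exists l; auto using le_refl|].
  destruct (HC1 _ Hv) as (a & b & _ & _ & Hb). now apply nlt_0 in Hb.
Qed.

(** The whole interval $[0,m]$ works: it has at most $d$ points, hence no two consecutive windows to
    compare. *)
Lemma ramsey_few_points d c m : m < nat_num d -> is_ramsey d c m m.
Proof.
  intros Hm. destruct (tuple_num_bound m d) as [B HB].
  apply is_ramsey_of_coded with B; [exact HB|]. intros y _ _.
  destruct (digit_comprehension X0 (m + 1) (m + 1) (fun i s => s = i)) as (h & Hh & Hd).
  - apply lt_0_succ.
  - definability.
  - intros i Hi. eauto.
  - exists h. split; [exact Hh|]. split.
    + intros i Hi Hi'. rewrite !Hd by assumption. apply lt_succ_diag.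
    + intros i _ Hi. exfalso. apply (lt_not_le _ _ Hi).
      eapply le_trans; [|apply le_plus_l]. now apply lt_succ_le.
Qed.

Lemma ramsey_many_points k c m :
  0 < m -> nat_num (S k) <= m + 1 -> is_ramsey (S (S k)) c m (tower_num k (m ^ c)).
Proof.
  intros Hm Hk. destruct (tuple_num_bound (tower_num k (m ^ c)) (S (S k))) as [B HB].
  apply is_ramsey_of_coded with B; [exact HB|]. intros y _ Hcol.
  apply homogeneous_exists; [exact Hk|exact Hm|apply le_refl|].
  intros l Hl Hinc. apply Hcol; [exact Hl| |exact Hinc].
  intros x Hx. apply lt_succ. eapply increasing_le; eassumption.
Qed.

Lemma ramsey_bound k (N : nat) c m :
  exists r, r <= tower_num k (m ^ (nat_num (S N) * c)) /\ is_ramsey (S (S k)) c m r.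
Proof.
  (* The case [c = 0] comes first, because the estimate of [m] by [m ^ (nat_num (S N) * c)] for few
     points requires a positive exponent. *)
  destruct (zero_or_succ c) as [-> |[c' Hc]].
  { exists (nat_num (S k)). split; [|apply ramsey_no_colors].
    rewrite mult_0_r, exp_0_r. apply nat_num_le_tower_num. }
  (* The labelling argument gives the exponent [c]; a positive factor such as $(d+1)!$ can only
     enlarge it. *)
  assert (Hle : c <= nat_num (S N) * c).
  { cbn [nat_num]. rewrite mult_succ_l. apply le_plus_l. }
  destruct (lt_or_le m (nat_num (S (S k)))) as [Hm|Hm].
  - exists m. split; [|now apply ramsey_few_points].
    eapply le_trans; [|apply le_tower_num].
    (* For [m = 0] the left side is 0; otherwise write [m] as [m ^ 1] and compare exponents. *)
    destruct (le_0_l m) as [Hm0|<-]; [|apply le_0_l].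
    rewrite <- (mult_1_r m) at 1. rewrite <- (exp_0_r m), <- exp_succ_r, plus_0_l.
    apply exp_le_r; [exact Hm0|]. eapply le_trans; [|exact Hle].
    rewrite Hc. apply le_plus_l.
  - assert (Hm0 : 0 < m) by (eapply lt_le_trans; [apply lt_0_succ|exact Hm]).
    exists (tower_num k (m ^ c)). split.
    + apply tower_num_le, exp_le_r; assumption.
    + apply ramsey_many_points; [exact Hm0|]. eapply le_trans; [|apply le_plus_r].
      eapply le_trans; [apply le_plus_r|exact Hm].
Qed.

Lemma sat_wr_bound e E k : sat e E (wr_bound (S (S k))).
Proof.
  intros c m. cbn [sat].
  set (N := fact (S (S k) + 1)). destruct (fact (S (S k) + 1)) as [|N'] eqn:HN.
  { now apply fact_neq_0 in HN. }
  destruct (ramsey_bound k N' c m) as (r & Hr & Hram).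
  destruct (least_ramsey _ _ _ _ Hram) as (r' & Hr' & Hram' & Hmin).
  exists r'. split; [split|].
  - now apply sat_weak_ramsey.
  - intros z Hz Hsat. apply sat_weak_ramsey in Hsat. rewrite !eval_shift in Hsat.
    exact (Hmin z Hz Hsat).
  - apply sat_Le. cbn [eval]. rewrite eval_tower. cbn [eval]. rewrite eval_numeral.
    replace (S (S k) - 2)%nat with k by lia. cbn [scons].
    eapply le_trans; eassumption.
Qed.

End Model.

Theorem theorem15 (d : nat) (hd : 2 <= d) : proves RCA0star nil (wr_bound d).
Proof.
  apply completeness. intros M HM e E.
  (* The environment of set variables provides the arbitrary oracle. *)
  destruct d as [|[|k]]; [lia..|]. apply sat_wr_bound; [exact HM|exact (E 0)].
Qed.
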